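(* Let $A$ be a symmetric quantum graded algebra with a straightening law on $(\Pi,\le)$ satisfying condition (C) (both notions are defined in the context). Then there exist maps $\mathbf q:\Pi\times\Pi\to\Bbbk^\ast$ and $\mathbf c:\underline{\rm inc}(\Pi\times\Pi)\to\Bbbk^\ast$ and a filtration $\mathcal F$ of the $\Bbbk$-algebra $A$ such that: (i) the associated graded ring $\mathrm{gr}_{\mathcal F}(A)=\bigoplus_{i\in\mathbb Z}\mathcal F_i/\mathcal F_{i-1}$ is isomorphic, as a $\Bbbk$-algebra, to $\mathcal A_{\Pi,\mathbf q,\mathbf c}$; (ii) standard monomials on $\Pi$ in $\mathcal A_{\Pi,\mathbf q,\mathbf c}$ are linearly independent. Further, $A$ is an integral domain.
   Context: $\Bbbk$ is a field; algebras are associative and unital, not necessarily commutative; an integral domain is a nonzero ring without zero divisors; $\mathbb N=\{0,1,2,\dots\}$. An ordered set is a partially ordered set; $\underline{\rm inc}(\Pi\times\Pi)$ is the set of pairs of incomparable elements of $\Pi$. A filtration $\mathcal F=(\mathcal F_i)_{i\in\mathbb Z}$ of a $\Bbbk$-algebra $A$ is an ascending family of $\Bbbk$-subspaces with $1\in\mathcal F_0$, $\mathcal F_i\mathcal F_j\subseteq\mathcal F_{i+j}$, $\bigcup_i\mathcal F_i=A$ (exhaustive) and $\bigcap_i\mathcal F_i=\{0\}$ (separated). Standard monomials: given a map $\iota:\Pi\to A$ from an ordered set to a ring, the standard monomial attached to a finite increasing sequence $\alpha_1\le\dots\le\alpha_t$ ($t\ge1$) in $\Pi$ is $\iota(\alpha_1)\cdots\iota(\alpha_t)$;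 to the empty sequence one attaches $1_A$. Linear independence of standard monomials means linear independence of the family indexed by finite increasing sequences. Symmetric quantum graded algebra with a straightening law (A.S.L.): an $\mathbb N$-graded $\Bbbk$-algebra $A$ with a finite ordered set $(\Pi,\le)$ and a map $\Pi\to A$ whose image consists of homogeneous elements of positive degree generating $A$ as a $\Bbbk$-algebra, such that (i) standard monomials on $\Pi$ are linearly independent (so $\Pi$ is identified with its image in $A$); (ii) for any pair $(\alpha,\beta)$ of incomparable elements of $\Pi$ there is a (necessarily unique) relation, the straightening relation, $\alpha\beta=\sum_{(\lambda,\mu)}c_{\lambda,\mu}^{\alpha,\beta}\lambda\mu$, the sum being over pairs $(\lambda,\mu)\in\Pi^2$ with $\lambda<\alpha,\beta<\mu$ (i.e. $\lambda<\alpha$, $\lambda<\beta$, $\alpha<\mu$, $\beta<\mu$), with $c_{\lambda,\mu}^{\alpha,\beta}\in\Bbbk$; (iii) for any pair $(\alpha,\beta)$ of elements of $\Pi$ there is a relation, called a commutation relation, $\alpha\beta-q_{\alpha\beta}\beta\alpha=\sum_{(\lambda,\mu)}d_{\lambda,\mu}^{\alpha,\beta}\lambda\mu$, the sum being over pairs $(\lambda,\mu)\in\Pi^2$ with $\lambda<\alpha,\beta<\mu$, with $d_{\lambda,\mu}^{\alpha,\beta}\in\Bbbk$ and $q_{\alpha\beta}\in\Bbbk^\ast$. Condition (C): let $\mathcal C_p=\{1,\dots,p\}$. An element $(i_1,\dots,i_d)\in\mathbb N^d$ is increasing if $i_1\le\dots\le i_d$; $\mathbb N^d$ has the product order. For $I,J\in\mathbb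 N^d$, $I\sqcup J$ denotes the multiset union of the coordinates of $I$ and of $J$. $A$ satisfies condition (C) if (iv) $(\Pi,\le)$ is a distributive lattice and there exist $d\ge1$, integers $n_1,\dots,n_d\ge2$ and an injective lattice morphism $\iota:\Pi\to\mathcal C_{n_1}\times\dots\times\mathcal C_{n_d}$ whose images are all increasing elements of $\mathbb N^d$; (v) for any incomparable $\alpha,\beta$, in the straightening relation one has $c_{\alpha\wedge\beta,\alpha\vee\beta}^{\alpha,\beta}\ne0$, and $c_{\lambda,\mu}^{\alpha,\beta}\ne0$ implies $\alpha\sqcup\beta=\lambda\sqcup\mu$ (elements of $\Pi$ being identified with their images under $\iota$); (vi) for any $(\alpha,\beta)\in\Pi^2$ there is a commutation relation with $d_{\alpha\wedge\beta,\alpha\vee\beta}^{\alpha,\beta}=0$ and such that $d_{\lambda,\mu}^{\alpha,\beta}\ne0$ implies $\alpha\sqcup\beta=\lambda\sqcup\mu$. Quantum toric algebra: for a finite distributive lattice $\Pi$ and maps $\mathbf q:\Pi\times\Pi\to\Bbbk^\ast$, $(\alpha,\beta)\mapsto q_{\alpha,\beta}$ and $\mathbf c:\underline{\rm inc}(\Pi\times\Pi)\to\Bbbk^\ast$, $(\alpha,\beta)\mapsto c_{\alpha,\beta}$, $\mathcal A_{\Pi,\mathbf q,\mathbf c}$ is the $\Bbbk$-algebra with generators $X_\alpha$ ($\alpha\in\Pi$) and relations $X_\alpha X_\beta=q_{\alpha,\beta}X_\beta X_\alpha$ for all $(\alpha,\beta)\in\Pi\times\Pi$ and $X_\alpha X_\beta=c_{\alpha,\beta}X_{\alpha\wedge\beta}X_{\alpha\vee\beta}$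 for all $(\alpha,\beta)\in\underline{\rm inc}(\Pi\times\Pi)$. Its standard monomials are formed via $\alpha\mapsto X_\alpha$. *)

(* Defs.v *)
From HB Require Import structures.
From mathcomp Require Import all_boot all_order all_algebra.
From mathcomp Require Import finmap boolp.
From mathcomp Require Import monalg.

Set Implicit Arguments.
Unset Strict Implicit.
Unset Printing Implicit Defensive.

Import Order.TTheory GRing.Theory.

Local Open Scope ring_scope.
Local Open Scope quotient_scope.

Definition is_domain (R : nzRingType) : Prop :=
  (1 : R) <> 0 /\ forall a b : R, a * b = 0 -> a = 0 \/ b = 0.

Definition isomorphic_algebras (k : fieldType) (B C : algType k) : Prop :=
  exists f : {lrmorphism B -> C}, bijective f.

Section StandardMonomials.
Variables (k : fieldType) (disp : Order.disp_t) (Pi : porderType disp).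
Variables (B : algType k) (x : Pi -> B).

Definition standard_monomial (s : seq Pi) : B := \prod_(a <- s) x a.

(* Linear independence of the family indexed by the increasing sequences (and
   not merely of the set of its values). *)
Definition standard_monomials_independent : Prop :=
  forall (S : seq (seq Pi)) (c : seq Pi -> k),
    uniq S -> (forall s, s \in S -> sorted <=%O s) ->
    \sum_(s <- S) c s *: standard_monomial s = 0 ->
    forall s, s \in S -> c s = 0.

End StandardMonomials.

Record is_grading (k : fieldType) (A : algType k) (gr : nat -> {pred A}) : Prop :=
  IsGrading {
  grading_submod : forall n, submod_closed (gr n);
  grading1 : 1 \in gr 0%N;
  gradingM : forall m n a b, a \in gr m -> b \in gr n -> a * b \in gr (m + n)%N;
  grading_span : forall a, exists n (f : nat -> A),
    (forall i, f i \in gr i) /\ a = \sum_(i < n) f i;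
  grading_direct : forall n (f : nat -> A),
    (forall i, f i \in gr i) -> \sum_(i < n) f i = 0 ->
    forall i, (i < n)%N -> f i = 0 }.

Section ASL.
Variables (k : fieldType) (disp : Order.disp_t) (A : algType k).

Section Relations.
Variables (Pi : porderType disp).

Definition encloses (a b : Pi) (p : Pi * Pi) : bool :=
  [&& (p.1 < a)%O, (p.1 < b)%O, (a < p.2)%O & (b < p.2)%O].

End Relations.

Section FiniteRelations.
Variables (Pi : finPOrderType disp) (x : Pi -> A).

(* In both relations the values of the coefficient function outside the range
   of summation are irrelevant. *)
Definition straightening_relation (a b : Pi) (c : Pi -> Pi -> k) : Prop :=
  x a * x b =
  \sum_(p : Pi * Pi | encloses a b p) c p.1 p.2 *: (x p.1 * x p.2).

Definition commutation_relation (a b : Pi) (q : k) (d : Pi -> Pi -> k) : Prop :=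
  q != 0 /\
  x a * x b - q *: (x b * x a) =
  \sum_(p : Pi * Pi | encloses a b p) d p.1 p.2 *: (x p.1 * x p.2).

Record symmetric_quantum_graded_asl (gr : nat -> {pred A}) : Prop :=
  SymmetricQuantumGradedASL {
  asl_grading : is_grading gr;
  asl_homogeneous : forall a, exists n, (0 < n)%N /\ x a \in gr n;
  asl_generates : forall S : {pred A}, subalg_closed S ->
    (forall a, x a \in S) -> forall u, u \in S;
  asl_independent : standard_monomials_independent x;
  asl_straightening : forall a b, (a >< b)%O ->
    exists c, straightening_relation a b c;
  asl_commutation : forall a b, exists q d, commutation_relation a b q d }.

End FiniteRelations.

Section ConditionC.
Variables (Pi : finDistrLatticeType disp) (x : Pi -> A).

(* d.-tupleprod nat is d.-tuple nat with the product order.  The product of the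
   chains {1, ..., n_i} is a sublattice of it, so a lattice morphism into that
   product is one into d.-tupleprod nat with values in the given bounds.
   Multiset unions of coordinates are concatenations up to permutation. *)
Record condition_C_for (d : nat) (iota : Pi -> d.-tupleprod nat) : Prop :=
  ConditionCFor {
  C_bounds : exists n : 'I_d -> nat, forall i,
    (2 <= n i)%N /\ forall a, (1 <= tnth (iota a) i <= n i)%N;
  C_injective : injective iota;
  C_meet : {morph iota : a b / (a `&` b)%O};
  C_join : {morph iota : a b / (a `|` b)%O};
  C_increasing : forall a, sorted leq (iota a);
  C_straightening : forall a b, (a >< b)%O ->
    exists c, [/\ straightening_relation x a b c,
      c (a `&` b)%O (a `|` b)%O != 0 &
      forall p, encloses a b p -> c p.1 p.2 != 0 ->
        perm_eq (iota a ++ iota b) (iota p.1 ++ iota p.2)];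
  C_commutation : forall a b,
    exists q d, [/\ commutation_relation x a b q d,
      d (a `&` b)%O (a `|` b)%O = 0 &
      forall p, encloses a b p -> d p.1 p.2 != 0 ->
        perm_eq (iota a ++ iota b) (iota p.1 ++ iota p.2)] }.

Definition condition_C : Prop :=
  exists d (iota : Pi -> d.-tupleprod nat), (1 <= d)%N /\ condition_C_for iota.

End ConditionC.
End ASL.

(* Properness is required because algType excludes the zero ring. *)
Record ideal2 (k : fieldType) (A : algType k) := Ideal2 {
  ideal2_pred :> {pred A};
  ideal2_zmod : zmod_closed ideal2_pred;
  ideal2_mull : forall a u, u \in ideal2_pred -> a * u \in ideal2_pred;
  ideal2_mulr : forall a u, u \in ideal2_pred -> u * a \in ideal2_pred;
  ideal2_proper : 1 \notin ideal2_pred }.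

Section QuotientAlgebra.
Variables (k : fieldType) (A : algType k) (I : ideal2 A).

HB.instance Definition _ := GRing.isZmodClosed.Build A (ideal2_pred I)
  (ideal2_zmod I).

Definition quotient_algebra : Type := Quotient.quot (ideal2_pred I).

HB.instance Definition _ := ZmodQuotient.on quotient_algebra.

Local Notation Q := quotient_algebra.

Lemma quotientP (u v : A) :
  reflect (u = v %[mod Q]) (u - v \in ideal2_pred I).
Proof. by rewrite (Quotient.idealrBE (ideal2_pred I)); apply: eqP. Qed.

Lemma subr_repr (u : A) : u - repr (\pi_Q u) \in ideal2_pred I.
Proof. by apply/quotientP; rewrite reprK. Qed.

Definition q_mul := lift_op2 Q *%R.
Definition q_scale (c : k) := lift_op1 Q ( *:%R c).

Lemma pi_q_mul : {morph \pi_Q : u v / u * v >-> q_mul u v}.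
Proof.
move=> u v; unlock q_mul; apply/quotientP.
rewrite -(subrK (u * repr (\pi_Q v)) (_ * _)) -addrA -mulrBl -mulrBr.
by apply: rpredD; [apply: ideal2_mull | apply: ideal2_mulr]; apply: subr_repr.
Qed.
Canonical pi_q_mul_morph := PiMorph2 pi_q_mul.

Lemma pi_q_scale c : {morph \pi_Q : u / c *: u >-> q_scale c u}.
Proof.
move=> u; unlock q_scale; apply/quotientP.
by rewrite -scalerBr -mulr_algl; apply/ideal2_mull/subr_repr.
Qed.
Canonical pi_q_scale_morph c := PiMorph1 (pi_q_scale c).

Lemma q_mulA : associative q_mul.
Proof. by move=> u v w; rewrite -[u]reprK -[v]reprK -[w]reprK !piE mulrA. Qed.
Lemma q_mul1l : left_id (\pi_Q 1) q_mul.
Proof. by move=> u; rewrite -[u]reprK !piE mul1r. Qed.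
Lemma q_mul1r : right_id (\pi_Q 1) q_mul.
Proof. by move=> u; rewrite -[u]reprK !piE mulr1. Qed.
Lemma q_mulDl : left_distributive q_mul +%R.
Proof. by move=> u v w; rewrite -[u]reprK -[v]reprK -[w]reprK !piE mulrDl. Qed.
Lemma q_mulDr : right_distributive q_mul +%R.
Proof. by move=> u v w; rewrite -[u]reprK -[v]reprK -[w]reprK !piE mulrDr. Qed.
Lemma q_one_neq0 : \pi_Q 1 != 0 :> Q.
Proof.
rewrite -(pi_zeror (s := Q)); apply/eqP => /quotientP.
by rewrite subr0; apply/negP/ideal2_proper.
Qed.

HB.instance Definition _ := GRing.Zmodule_isNzRing.Build Q
  q_mulA q_mul1l q_mul1r q_mulDl q_mulDr q_one_neq0.

Lemma q_scaleA a b (u : Q) : q_scale a (q_scale b u) = q_scale (a * b) u.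
Proof. by rewrite -[u]reprK !piE scalerA. Qed.
Lemma q_scale1 : left_id 1 q_scale.
Proof. by move=> u; rewrite -[u]reprK !piE scale1r. Qed.
Lemma q_scaleDr : right_distributive q_scale +%R.
Proof. by move=> c u v; rewrite -[u]reprK -[v]reprK !piE scalerDr. Qed.
Lemma q_scaleDl (u : Q) : {morph q_scale^~ u : a b / a + b}.
Proof. by move=> a b; rewrite -[u]reprK !piE scalerDl. Qed.

HB.instance Definition _ := GRing.Zmodule_isLmodule.Build k Q
  q_scaleA q_scale1 q_scaleDr q_scaleDl.

Lemma q_scaleAl (c : k) (u v : Q) : q_scale c (q_mul u v) = q_mul (q_scale c u) v.
Proof. by rewrite -[u]reprK -[v]reprK !piE scalerAl. Qed.

HB.instance Definition _ := GRing.Lmodule_isLalgebra.Build k Q q_scaleAl.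

Lemma q_scaleAr (c : k) (u v : Q) : q_scale c (q_mul u v) = q_mul u (q_scale c v).
Proof. by rewrite -[u]reprK -[v]reprK !piE scalerAr. Qed.

HB.instance Definition _ := GRing.Lalgebra_isAlgebra.Build k Q q_scaleAr.

Definition quotient_pi (u : A) : Q := \pi_Q u.

Lemma quotient_pi_is_zmod_morphism : zmod_morphism quotient_pi.
Proof. by move=> u v; rewrite /quotient_pi !piE. Qed.
Lemma quotient_pi_is_monoid_morphism : monoid_morphism quotient_pi.
Proof. by split=> // u v; rewrite /quotient_pi pi_q_mul. Qed.
Lemma quotient_pi_is_scalable : scalable quotient_pi.
Proof. by move=> c u; rewrite /quotient_pi pi_q_scale. Qed.

HB.instance Definition _ := GRing.isZmodMorphism.Build A Q quotient_pi
  quotient_pi_is_zmod_morphism.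
HB.instance Definition _ := GRing.isMonoidMorphism.Build A Q quotient_pi
  quotient_pi_is_monoid_morphism.
HB.instance Definition _ := GRing.isScalable.Build k A Q *:%R quotient_pi
  quotient_pi_is_scalable.

End QuotientAlgebra.

Record filtration (k : fieldType) (A : algType k) := Filtration {
  filt :> int -> {pred A};
  filt_submod : forall i, submod_closed (filt i);
  filt_ascending : forall i j, (i <= j)%O -> {subset filt i <= filt j};
  filt1 : 1 \in filt 0;
  filtM : forall i j a b, a \in filt i -> b \in filt j -> a * b \in filt (i + j);
  filt_exhaustive : forall a, exists i, a \in filt i;
  filt_separated : forall a, (forall i, a \in filt i) -> a = 0 }.

(* The algebra of finitely supported families (a_i)_(i : M) of elements of an
   algebra A, indexed by a monoid M, under convolution.  The rings {malg A[M]}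
   of multinomials exclude monoids with nontrivial units such as (int, +), so
   only the additive group of {malg A[M]} is used. *)
Definition monoid_algebra (k : fieldType) (A : algType k) (M : choiceType) (e : M)
    (op : Monoid.law e) : Type :=
  {malg A[M]}.

Section MonoidAlgebra.
Variables (k : fieldType) (A : algType k).
Variables (M : choiceType) (e : M) (op : Monoid.law e).

Local Notation MA := (monoid_algebra A op).

HB.instance Definition _ := GRing.Zmodule.on MA.

Implicit Types (g h : MA) (i j : M).

Definition macoef (i : M) (g : MA) : A := mcoeff i g.

Definition mamonom (i : M) (a : A) : MA := mkmalgU i a.

(* Both operations are locked to keep unification from unfolding them. *)
Fact monoid_algebra_key : unit. Proof. by []. Qed.

Definition mamul : MA -> MA -> MA :=
  locked_with monoid_algebra_key (fun g h =>
    \sum_(i <- msupp g) \sum_(j <- msupp h)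
      mamonom (op i j) (macoef i g * macoef j h)).

Definition mascale : k -> MA -> MA :=
  locked_with monoid_algebra_key (fun c g =>
    \sum_(i <- msupp g) mamonom i (c *: macoef i g)).

Lemma mamul_def g h : mamul g h =
  \sum_(i <- msupp g) \sum_(j <- msupp h) mamonom (op i j) (macoef i g * macoef j h).
Proof. by rewrite /mamul unlock. Qed.

Lemma mascale_def c g : mascale c g = \sum_(i <- msupp g) mamonom i (c *: macoef i g).
Proof. by rewrite /mascale unlock. Qed.

Lemma macoef_monom i a j : macoef j (mamonom i a) = a *+ (i == j).
Proof. exact: mcoeffU. Qed.

Lemma maP g h : (forall i, macoef i g = macoef i h) -> g = h.
Proof. by move=> gh; apply/malgP. Qed.

Lemma macoef_is_zmod_morphism i : zmod_morphism (macoef i).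
Proof. by move=> g h; rewrite /macoef mcoeffB. Qed.
HB.instance Definition _ i := GRing.isZmodMorphism.Build MA A (macoef i)
  (macoef_is_zmod_morphism i).

Lemma macoef0 i : macoef i 0 = 0.
Proof. exact: raddf0. Qed.
Lemma macoefD i g h : macoef i (g + h) = macoef i g + macoef i h.
Proof. exact: (raddfD (macoef i)). Qed.

Lemma mamonom_is_zmod_morphism i : zmod_morphism (mamonom i).
Proof. by move=> a b; rewrite /mamonom monalgUB. Qed.
HB.instance Definition _ i := GRing.isZmodMorphism.Build A MA (mamonom i)
  (mamonom_is_zmod_morphism i).

Lemma macoef_outdom g i : i \notin msupp g -> macoef i g = 0.
Proof. exact: mcoeff_outdom. Qed.

Lemma maE g : g = \sum_(i <- msupp g) mamonom i (macoef i g).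
Proof. exact: monalgE. Qed.

Lemma mamulE (d d' : {fset M}) g h :
  (msupp g `<=` d)%fset -> (msupp h `<=` d')%fset ->
  mamul g h = \sum_(i <- d) \sum_(j <- d') mamonom (op i j) (macoef i g * macoef j h).
Proof.
move=> gd he; rewrite mamul_def (big_fset_incl _ gd) => [|i _ gi] /=; last first.
  by apply: big1 => j _; rewrite macoef_outdom // mul0r raddf0.
apply: eq_bigr => i _; apply: big_fset_incl => // j _ hj.
by rewrite (macoef_outdom hj) mulr0 raddf0.
Qed.

Lemma mamulDl : left_distributive mamul +%R.
Proof.
move=> g g' h; pose d := (msupp g `|` msupp g')%fset.
rewrite (@mamulE d (msupp h)) ?fsubset_refl ?msuppD_le //.
rewrite (@mamulE d (msupp h) g) ?fsubset_refl ?fsubsetUl //.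
rewrite (@mamulE d (msupp h) g') ?fsubset_refl ?fsubsetUr //.
rewrite -big_split; apply: eq_bigr => i _; rewrite -big_split.
by apply: eq_bigr => j _; rewrite /= raddfD mulrDl raddfD.
Qed.

Lemma mamulDr : right_distributive mamul +%R.
Proof.
move=> g h h'; pose d := (msupp h `|` msupp h')%fset.
rewrite (@mamulE (msupp g) d) ?fsubset_refl ?msuppD_le //.
rewrite (@mamulE (msupp g) d _ h) ?fsubset_refl ?fsubsetUl //.
rewrite (@mamulE (msupp g) d _ h') ?fsubset_refl ?fsubsetUr //.
rewrite -big_split; apply: eq_bigr => i _; rewrite -big_split.
by apply: eq_bigr => j _; rewrite /= raddfD mulrDr raddfD.
Qed.

Lemma mamul0l : left_zero 0 mamul.
Proof. by move=> g; apply: (addrI (mamul 0 g)); rewrite -mamulDl !addr0. Qed.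

Lemma mamul0r : right_zero 0 mamul.
Proof. by move=> g; apply: (addrI (mamul g 0)); rewrite -mamulDr !addr0. Qed.

Lemma mamul_monom i j a b :
  mamul (mamonom i a) (mamonom j b) = mamonom (op i j) (a * b).
Proof.
rewrite (@mamulE [fset i]%fset [fset j]%fset) ?msuppU_le //.
by rewrite !big_seq_fset1 !macoef_monom !eqxx.
Qed.

Lemma mamul_suml (I : Type) (r : seq I) (f : I -> MA) h :
  mamul (\sum_(i <- r) f i) h = \sum_(i <- r) mamul (f i) h.
Proof. exact: (big_morph (mamul^~ h) (fun _ _ => mamulDl _ _ _) (mamul0l h)). Qed.

Lemma mamul_sumr (I : Type) (r : seq I) (f : I -> MA) g :
  mamul g (\sum_(i <- r) f i) = \sum_(i <- r) mamul g (f i).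
Proof. exact: (big_morph (mamul g) (fun _ _ => mamulDr _ _ _) (mamul0r g)). Qed.

Lemma mamulA : associative mamul.
Proof.
move=> g1 g2 g3; rewrite [g1]maE !mamul_suml; apply: eq_bigr => i _.
rewrite [g2]maE mamul_suml !mamul_sumr mamul_suml; apply: eq_bigr => j _.
rewrite [g3]maE !mamul_sumr; apply: eq_bigr => l _.
by rewrite !mamul_monom Monoid.mulmA mulrA.
Qed.

Lemma mamul1l : left_id (mamonom e 1) mamul.
Proof.
move=> g; rewrite [in LHS](maE g) mamul_sumr [RHS]maE.
by apply: eq_bigr => i _; rewrite mamul_monom Monoid.mul1m mul1r.
Qed.

Lemma mamul1r : right_id (mamonom e 1) mamul.
Proof.
move=> g; rewrite [in LHS](maE g) mamul_suml [RHS]maE.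
by apply: eq_bigr => i _; rewrite mamul_monom Monoid.mulm1 mulr1.
Qed.

Lemma maone_neq0 : mamonom e 1 != 0.
Proof.
apply/eqP => /(congr1 (macoef e)); rewrite macoef_monom eqxx raddf0.
by apply/eqP/oner_neq0.
Qed.

HB.instance Definition _ := GRing.Zmodule_isNzRing.Build MA
  mamulA mamul1l mamul1r mamulDl mamulDr maone_neq0.

Lemma macoefZ c g i : macoef i (mascale c g) = c *: macoef i g.
Proof.
rewrite [in RHS](maE g) mascale_def !(raddf_sum (macoef i)) scaler_sumr.
by apply: eq_bigr => j _; rewrite /= !macoef_monom scalerMnr.
Qed.

Lemma mascaleA a b g : mascale a (mascale b g) = mascale (a * b) g.
Proof. by apply: maP => i; rewrite !macoefZ scalerA. Qed.
Lemma mascale1 : left_id 1 mascale.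
Proof. by move=> g; apply: maP => i; rewrite !macoefZ scale1r. Qed.
Lemma mascaleDr : right_distributive mascale +%R.
Proof.
move=> c g h; apply: maP => i.
by rewrite !(macoefZ, macoefD) scalerDr.
Qed.
Lemma mascaleDl g : {morph mascale^~ g : a b / a + b}.
Proof.
move=> a b; apply: maP => i.
by rewrite !(macoefZ, macoefD) scalerDl.
Qed.

HB.instance Definition _ := GRing.Zmodule_isLmodule.Build k MA
  mascaleA mascale1 mascaleDr mascaleDl.

Lemma macoefM g h n : macoef n (g * h) =
  \sum_(i <- msupp g) \sum_(j <- msupp h) (macoef i g * macoef j h) *+ (op i j == n).
Proof.
rewrite -[g * h]/(mamul g h) mamul_def (raddf_sum (macoef n)).
apply: eq_bigr => i _.
by rewrite (raddf_sum (macoef n)); apply: eq_bigr => j _; rewrite /= macoef_monom.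
Qed.

Lemma mascale_monom c i a : c *: mamonom i a = mamonom i (c *: a).
Proof. by apply: maP => j; rewrite macoefZ !macoef_monom scalerMnr. Qed.

Lemma mascaleAl (c : k) g h : c *: (g * h) = (c *: g) * h.
Proof.
rewrite [g]maE scaler_sumr !mulr_suml scaler_sumr; apply: eq_bigr => i _.
rewrite [h]maE !mulr_sumr scaler_sumr; apply: eq_bigr => j _.
by rewrite mascale_monom -[*%R]/mamul !mamul_monom mascale_monom scalerAl.
Qed.

HB.instance Definition _ := GRing.Lmodule_isLalgebra.Build k MA mascaleAl.

Lemma mascaleAr (c : k) g h : c *: (g * h) = g * (c *: h).
Proof.
rewrite [g]maE !mulr_suml scaler_sumr; apply: eq_bigr => i _.
rewrite [h]maE mulr_sumr !scaler_sumr mulr_sumr; apply: eq_bigr => j _.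
by rewrite mascale_monom -[*%R]/mamul !mamul_monom mascale_monom scalerAr.
Qed.

HB.instance Definition _ := GRing.Lalgebra_isAlgebra.Build k MA mascaleAr.

End MonoidAlgebra.

Arguments mamonom {k A M e op} i a.
Arguments macoef {k A M e op} i g.

(* A[t, t^-1] *)
Notation laurent A := (monoid_algebra A (+%R : Monoid.law (0 : int))).

Section AssociatedGraded.
Variables (k : fieldType) (A : algType k) (F : filtration A).

Definition in_shift (m : int) : {pred laurent A} :=
  [pred g : laurent A | all (fun i => macoef i g \in F (i - m)) (msupp g)].

Lemma in_shiftP m (g : laurent A) :
  reflect (forall i, macoef i g \in F (i - m)) (g \in in_shift m).
Proof.
have F0 i : 0 \in F i by case: (filt_submod F i).
apply: (iffP allP) => [Fg i|Fg i _]; last exact: Fg.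
by have [/Fg//|/macoef_outdom->] := boolP (i \in msupp g).
Qed.

Lemma in_shift_submod m : submod_closed (in_shift m).
Proof.
split=> [|c g h /in_shiftP Fg /in_shiftP Fh]; apply/in_shiftP => i.
  by rewrite raddf0; case: (filt_submod F (i - m)).
rewrite macoefD macoefZ.
by case: (filt_submod F (i - m)) => _; apply.
Qed.

Lemma in_shiftM m n g h :
  g \in in_shift m -> h \in in_shift n -> g * h \in in_shift (m + n).
Proof.
move=> /in_shiftP Fg /in_shiftP Fh; apply/in_shiftP => l.
have [F0 FD] := filt_submod F (l - (m + n)).
have FD' a b : a \in F (l - (m + n)) -> b \in F (l - (m + n)) ->
  a + b \in F (l - (m + n)) by move=> Fa; rewrite -[a]scale1r; apply: FD.
rewrite macoefM; apply: (big_ind (fun u => u \in _)) => // i _.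
apply: (big_ind (fun u => u \in _)) => // j _.
have [<-|_] := eqVneq (i + j) l; last by rewrite mulr0n.
by rewrite opprD addrACA; apply: filtM.
Qed.

Lemma in_shift1 : 1 \in in_shift 0.
Proof.
apply/in_shiftP => i; rewrite macoef_monom subr0.
have [<-|_] := eqVneq 0 i; first exact: filt1.
by case: (filt_submod F i).
Qed.

Lemma in_shift_le m n : (m <= n)%O -> {subset in_shift n <= in_shift m}.
Proof.
move=> mn g /in_shiftP Fg; apply/in_shiftP => i.
by apply: filt_ascending (Fg i); rewrite Num.Theory.lerD2l Num.Theory.lerN2.
Qed.

Lemma in_shift0_subalg : subalg_closed (in_shift 0).
Proof.
split; [exact: in_shift1 | by case: (in_shift_submod 0) | ].
by move=> g h Fg Fh; have := in_shiftM Fg Fh; rewrite addr0.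
Qed.

HB.instance Definition _ := GRing.isSubalgClosed.Build k (laurent A) (in_shift 0)
  in_shift0_subalg.

(* The direct sum of the F i, as the subalgebra of A[t, t^-1] formed by the
   families whose i-th term lies in F i. *)
Definition rees : Type := {g : laurent A | g \in in_shift 0}.

HB.instance Definition _ := [isSub of rees for @sval _ _].
HB.instance Definition _ := [Choice of rees by <:].
HB.instance Definition _ := [SubChoice_isSubAlgebra of rees by <:].

(* The direct sum of the F (i - 1). *)
Definition gr_ideal_pred : {pred rees} := [pred g : rees | val g \in in_shift 1].

Lemma gr_ideal_zmod : zmod_closed gr_ideal_pred.
Proof.
have [sh0 shD] := in_shift_submod 1.
split=> [|g h Fg Fh]; rewrite !inE ?raddf0 // raddfB /=.
by rewrite addrC -scaleN1r; apply: shD.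
Qed.

Lemma gr_ideal_mull a g : g \in gr_ideal_pred -> a * g \in gr_ideal_pred.
Proof.
by rewrite !inE rmorphM => /(in_shiftM (valP a)); rewrite add0r.
Qed.

Lemma gr_ideal_mulr a g : g \in gr_ideal_pred -> g * a \in gr_ideal_pred.
Proof.
by rewrite !inE rmorphM => /in_shiftM/(_ (valP a)); rewrite addr0.
Qed.

Lemma gr_ideal_proper : 1 \notin gr_ideal_pred.
Proof.
apply/negP => /in_shiftP/(_ 0); rewrite rmorph1 macoef_monom eqxx sub0r => F1.
have F1n n : 1 \in F (- n%:Z).
  elim: n => [|n IHn]; first by rewrite oppr0; apply: filt1.
  by rewrite -addn1 PoszD opprD -[1]mulr1; apply: filtM.
suff /eqP : (1 : A) = 0 by rewrite oner_eq0.
apply: (@filt_separated _ _ F) => -[n|n]; last by rewrite NegzE.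
exact: filt_ascending (filt1 F).
Qed.

Definition gr_ideal : ideal2 rees :=
  Ideal2 gr_ideal_zmod gr_ideal_mull gr_ideal_mulr gr_ideal_proper.

(* gr_F(A) = \bigoplus_i F_i / F_(i-1), as the quotient of the direct sum of
   the F_i by the direct sum of the F_(i-1). *)
Definition associated_graded := quotient_algebra gr_ideal.

HB.instance Definition _ := GRing.Algebra.on associated_graded.

End AssociatedGraded.

Section GeneratedIdeal.
Variables (k : fieldType) (A : algType k) (S : A -> Prop).

Definition generated_ideal : {pred A} := fun u =>
  `[< exists s : seq (A * A * A), (forall t, t \in s -> S t.1.2) /\
        u = \sum_(t <- s) t.1.1 * t.1.2 * t.2 >].

Lemma generated_idealP u :
  reflect (exists s : seq (A * A * A), (forall t, t \in s -> S t.1.2) /\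
             u = \sum_(t <- s) t.1.1 * t.1.2 * t.2)
          (u \in generated_ideal).
Proof. exact: asboolP. Qed.

Lemma generated_ideal_mull a u :
  u \in generated_ideal -> a * u \in generated_ideal.
Proof.
case/generated_idealP => s [Ss ->]; apply/generated_idealP.
exists [seq (a * t.1.1, t.1.2, t.2) | t <- s]; split.
  by move=> _ /mapP[t ts ->]; apply: (Ss t).
rewrite big_map mulr_sumr; apply: eq_bigr => t _ /=.
by rewrite !mulrA.
Qed.

Lemma generated_ideal_mulr a u :
  u \in generated_ideal -> u * a \in generated_ideal.
Proof.
case/generated_idealP => s [Ss ->]; apply/generated_idealP.
exists [seq (t.1.1, t.1.2, t.2 * a) | t <- s]; split.
  by move=> _ /mapP[t ts ->]; apply: (Ss t).
rewrite big_map mulr_suml; apply: eq_bigr => t _ /=.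
by rewrite !mulrA.
Qed.

Lemma generated_ideal_zmod : zmod_closed generated_ideal.
Proof.
split=> [|u v Iu Iv].
  by apply/generated_idealP; exists [::]; rewrite big_nil.
have /generated_idealP[s' [Ss' Dv]] := generated_ideal_mull (-1) Iv.
have /generated_idealP[s [Ss Du]] := Iu.
apply/generated_idealP; exists (s ++ s').
rewrite big_cat /= -Dv -Du mulN1r; split=> // t.
by rewrite mem_cat => /orP[/Ss|/Ss'].
Qed.

End GeneratedIdeal.

(* The monoid algebra of the free monoid of words on I. *)
Notation free_algebra k I :=
  (monoid_algebra (k^o : algType k) (cat : Monoid.law ([::] : seq I))).

Section FreeAlgebra.
Variables (k : fieldType) (I : choiceType).

Definition free_gen (i : I) : free_algebra k I := mamonom [:: i] 1.

Implicit Types (u v : free_algebra k I).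

Definition const_coef u : k := macoef [::] u.

Lemma const_coef1 : const_coef 1 = 1.
Proof. by rewrite /const_coef macoef_monom eqxx. Qed.

Lemma const_coef_sum (T : eqType) (s : seq T) (f : T -> free_algebra k I) :
  (forall t, t \in s -> const_coef (f t) = 0) ->
  const_coef (\sum_(t <- s) f t) = 0.
Proof.
by move=> f0; rewrite /const_coef (raddf_sum (macoef [::])) big_seq big1.
Qed.

Lemma const_coef_mull u v : const_coef v = 0 -> const_coef (u * v) = 0.
Proof.
move=> v0; rewrite /const_coef macoefM; apply: big1 => i _; apply: big1 => j _.
by case: j => [|x j]; [rewrite [macoef _ v]v0 mulr0 mul0rn | case: i].
Qed.

Lemma const_coef_mulr u v : const_coef u = 0 -> const_coef (u * v) = 0.
Proof.
move=> u0; rewrite /const_coef macoefM; apply: big1 => i _; apply: big1 => j _.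
by case: i => [|x i]; [rewrite [macoef _ u]u0 mul0r mul0rn |].
Qed.

Lemma const_coef_relator a b a' b' (s : k) :
  const_coef (free_gen a * free_gen b - s *: (free_gen a' * free_gen b')) = 0.
Proof.
have gen0 i : const_coef (free_gen i) = 0 by rewrite /const_coef macoef_monom.
have prod0 i j : const_coef (free_gen i * free_gen j) = 0.
  exact/const_coef_mulr/gen0.
rewrite /const_coef (raddfB (macoef [::])) /=.
rewrite [macoef _ (free_gen a * _)]prod0 macoefZ.
by rewrite [macoef _ (free_gen a' * _)]prod0 scaler0 subr0.
Qed.

End FreeAlgebra.

Section QuantumToric.
Variables (k : fieldType) (disp : Order.disp_t) (Pi : finDistrLatticeType disp).
(* Only the values of c on pairs of incomparable elements matter. *)
Variables (q c : Pi -> Pi -> k).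

Local Notation X := (@free_gen k Pi).

Definition toric_relator (r : free_algebra k Pi) : Prop :=
  (exists a b, r = X a * X b - q a b *: (X b * X a)) \/
  (exists a b, (a >< b)%O /\
     r = X a * X b - c a b *: (X (a `&` b)%O * X (a `|` b)%O)).

Lemma toric_relator_const r : toric_relator r -> const_coef r = 0.
Proof. by case=> [[a [b ->]]|[a [b [_ ->]]]]; apply: const_coef_relator. Qed.

Lemma toric_proper : 1 \notin generated_ideal toric_relator.
Proof.
apply/negP => /generated_idealP[s [Ss Ds]].
have /eqP := const_coef1 k Pi; rewrite Ds eq_sym const_coef_sum ?oner_eq0 //.
move=> t /Ss/toric_relator_const t0.
by apply: const_coef_mulr; apply: const_coef_mull.
Qed.

Definition toric_ideal : ideal2 (free_algebra k Pi) :=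
  Ideal2 (generated_ideal_zmod toric_relator)
    (generated_ideal_mull (S := toric_relator))
    (generated_ideal_mulr (S := toric_relator)) toric_proper.

Definition quantum_toric := quotient_algebra toric_ideal.

HB.instance Definition _ := GRing.Algebra.on quantum_toric.

Definition toric_gen (a : Pi) : quantum_toric := quotient_pi toric_ideal (X a).

End QuantumToric.

(* Main.v *)
From HB Require Import structures.
Require Import Defs.
From mathcomp Require Import all_boot all_order all_algebra.
From mathcomp Require Import finmap boolp monalg zify.

(* Weight a in Pi by w a = \sum_j (2 j + 1) (iota a)_j.  On pairs of increasing
   tuples l <= m with a given multiset of coordinates, w l + w m strictly decreases
   when the pair is spread apart; hence, in the straightening and commutation
   relations of a b, all terms other than those in b a and (a /\ b) (a \/ b) have
   weight less than w a + w b.  Let F_i be the span of the words of weight at most i.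
   In gr_F(A) the generators satisfy the toric relations, and these rewrite every
   word as a nonzero multiple of one standard monomial.  Therefore standard
   monomials of weight at most i span F_i, so that those of gr_F(A) are independent
   and the toric algebra maps isomorphically onto gr_F(A).

   Straightening a word by toric relations preserves, for each j and v, the number
   of letters whose j-th coordinate is v, and these numbers determine a standard
   monomial.  Ordering standard monomials lexicographically by w and then by these
   numbers, leading terms multiply without cancellation and A is a domain. *)

Set Implicit Arguments.
Unset Strict Implicit.
Unset Printing Implicit Defensive.

Import Order.TTheory GRing.Theory.

(** * Weights of increasing tuples *)

Definition moment (t : seq nat) : nat := \sum_(0 <= i < size t) i.*2.+1 * nth 0 t i.

(** Moving the entries of [t] one place to the right raises each odd coefficient by 2. *)
Lemma moment_cons x t : moment (x :: t) = x + moment t + (sumn t).*2.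
Proof.
rewrite /moment big_nat_recl //= mul1n -addnA; congr (_ + _).
rewrite -[t in sumn t](mkseq_nth 0) /mkseq sumnE big_map.
rewrite -{2}[size t]subn0 -/(index_iota _ _) -muln2 big_distrl -big_split /=.
by apply: eq_bigr => i _; lia.
Qed.

Lemma sum_lt x n : x <= n -> \sum_(0 <= v < n) (v < x)%N = x.
Proof.
move=> xn; rewrite (big_cat_nat (n := x)) //=.
rewrite (eq_big_nat _ _ (F2 := fun=> 1)) => [|i /andP[_ ->]] //.
rewrite [X in _ + X](eq_big_nat _ _ (F2 := fun=> 0)) => [|i /andP[xi _]]; last first.
  by rewrite ltnNge xi.
by rewrite !sum_nat_const_nat muln0 muln1 subn0 addn0.
Qed.

(** Layer-cake summation: an entry [x <= n] exceeds exactly [x] of the levels [v < n]. *)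
Lemma sum_count_gt n (t : seq nat) : all (leq^~ n) t ->
  \sum_(0 <= v < n) count (ltn v) t = sumn t.
Proof.
elim: t => [_|x t IH /= /andP[xn tn]]; first by rewrite big1.
by rewrite big_split /= sum_lt // IH.
Qed.

(* For sorted t the entries exceeding v are the last c of them, and c ^ 2 is
   the sum of the first c odd numbers. *)
Lemma moment_count n (t : seq nat) : sorted leq t -> all (leq^~ n) t ->
  moment t + \sum_(0 <= v < n) (count (ltn v) t) ^ 2 = (size t).*2 * sumn t.
Proof.
elim: t => [_ _|x t IH xt /= /andP[xn tn]].
  by rewrite /moment big_geq // big1.
have /= := IH (path_sorted xt) tn; rewrite moment_cons.
(* Prepending the minimum [x] affects only the levels [v < x]; there all of [t] is counted, and the
   square grows by [2 * size t + 1]. *)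
have -> : \sum_(0 <= v < n) ((v < x)%N + count (ltn v) t) ^ 2 =
    (size t).*2.+1 * x + \sum_(0 <= v < n) count (ltn v) t ^ 2.
  rewrite -{2}(sum_lt xn) big_distrr -big_split /=; apply: eq_bigr => v _.
  case: ltnP => vx; last by rewrite muln0.
  have /eqP -> : count (ltn v) t == size t; last by lia.
  rewrite -all_count; apply: sub_all (order_path_min leq_trans xt).
  by move=> y; apply: leq_trans.
by nia.
Qed.

(** Convexity of the square: with l = a - e and m = b + e the squares grow by 2e(b - a + e), which
    is at least e for a natural number e. This linear gain later gives strictness. *)
Lemma sq_spread (l a b m : nat) : l <= a -> a <= b -> l + m = a + b ->
  a ^ 2 + b ^ 2 + a <= l ^ 2 + m ^ 2 + l.
Proof.
move=> la ab lmab; have [e De] : exists e, a = l + e by exists (a - l); lia.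
by have -> : m = b + e by [lia]; rewrite De -!mulnn in ab *; nia.
Qed.

Lemma le_count_gt v n (s t : n.-tuple nat) :
  (forall i, tnth s i <= tnth t i) -> count (ltn v) s <= count (ltn v) t.
Proof.
move=> st; rewrite -(map_tnth_enum s) -(map_tnth_enum t) !count_map.
by apply: sub_count => i /= /leq_trans; apply; apply: st.
Qed.

Lemma sumn_tuple n (s : n.-tuple nat) : sumn s = \sum_(i < n) tnth s i.
Proof. by rewrite sumnE big_tuple. Qed.

Lemma eq_tuple_sumn n (s t : n.-tuple nat) :
  (forall i, tnth s i <= tnth t i) -> sumn t <= sumn s -> s = t.
Proof.
rewrite !sumn_tuple => st ts; apply: eq_from_tnth => i; apply/eqP.
rewrite eqn_leq st /= leqNgt; apply/negP => lt_i.
move: ts; rewrite leqNgt; apply/negP/negPn.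
rewrite (bigD1 i) // [X in _ < X](bigD1 i) //= -addSn leq_add // leq_sum //.
Qed.

(** By [moment_count] the total moment of a pair is a constant minus the squares of its level
    counts. Convexity at every level adds up to a gain of at least [sumn a - sumn l], which is
    positive unless [l = a]. *)
Lemma moment_spread n (l a b m : n.-tuple nat) :
  sorted leq l -> sorted leq a -> sorted leq b -> sorted leq m ->
  (forall i, tnth l i <= tnth a i) -> (forall i, tnth a i <= tnth b i) ->
  (forall i, tnth b i <= tnth m i) -> perm_eq (a ++ b) (l ++ m) ->
  l = a /\ m = b \/ moment l + moment m < moment a + moment b.
Proof.
move=> sl sa sb sm la ab bm /[dup] /perm_sumn + /permP cnt.
rewrite !sumn_cat => sums.
have [al|] := leqP (sumn a) (sumn l).
  by left; split; [|symmetry]; apply: eq_tuple_sumn => //; lia.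
move=> ltla; right.
pose N := \max_(i <- a ++ b ++ l ++ m) i.
have le_N (t : seq nat) : {subset t <= a ++ b ++ l ++ m} -> all (leq^~ N) t.
  by move=> tS; apply/allP => i /tS iS; apply: leq_bigmax_seq.
have lN : all (leq^~ N) l by apply: le_N => i; rewrite !mem_cat => ->; rewrite !orbT.
have aN : all (leq^~ N) a by apply: le_N => i; rewrite !mem_cat => ->.
have bN : all (leq^~ N) b by apply: le_N => i; rewrite !mem_cat => ->; rewrite !orbT.
have mN : all (leq^~ N) m by apply: le_N => i; rewrite !mem_cat => ->; rewrite !orbT.
have := moment_count sl lN; have := moment_count sa aN.
have := moment_count sb bN; have := moment_count sm mN; rewrite !size_tuple.
suff : \sum_(0 <= v < N) count (ltn v) a ^ 2 + \sum_(0 <= v < N) count (ltn v) b ^ 2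
    + sumn a <= \sum_(0 <= v < N) count (ltn v) l ^ 2
    + \sum_(0 <= v < N) count (ltn v) m ^ 2 + sumn l by nia.
rewrite -(sum_count_gt aN) -(sum_count_gt lN) -!big_split /=.
apply: leq_sum => v _; apply: sq_spread; [exact: le_count_gt..|].
by have := cnt (ltn v); rewrite !count_cat.
Qed.

(** * Straightening words in a distributive lattice *)

Section Straightening.
Variables (disp : Order.disp_t) (Pi : distrLatticeType disp).
Implicit Types (a b : Pi) (s u : seq Pi) (f : Pi -> nat).

(** These are the valuations of the lattice. *)
Definition modular f : Prop :=
  forall a b, f (a `&` b)%O + f (a `|` b)%O = f a + f b.

Definition weight f u : nat := \sum_(a <- u) f a.

Lemma weight_cons f a u : weight f (a :: u) = f a + weight f u.
Proof. exact: big_cons. Qed.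

Lemma weight_cat f u v : weight f (u ++ v) = weight f u + weight f v.
Proof. exact: big_cat. Qed.

(** Insertion into a sorted list with minimum and maximum replaced by meet and join; the join is
    carried along, so each step rewrites two adjacent letters as a toric relation does. *)
Fixpoint insert a s : seq Pi :=
  if s is b :: s' then (a `&` b)%O :: insert (a `|` b)%O s' else [:: a].

Definition straighten u : seq Pi := foldr insert [::] u.

Lemma weight_insert f a s : modular f -> weight f (insert a s) = f a + weight f s.
Proof.
move=> fM; elim: s a => [|b s IH] a /=; first by rewrite weight_cons.
by rewrite !weight_cons IH addnA fM addnA.
Qed.

Lemma weight_straighten f u : modular f -> weight f (straighten u) = weight f u.
Proof. by move=> fM; elim: u => //= a u IH; rewrite weight_insert // IH weight_cons. Qed.

Lemma insert_ge c a s :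
  (c <= a)%O -> all (>= c)%O s -> all (>= c)%O (insert a s).
Proof.
elim: s a => [|b s IH] a ca /=; first by rewrite ca.
by case/andP=> cb cs; rewrite lexI ca cb IH // lexU2 // ca.
Qed.

Lemma sorted_insert a s : sorted <=%O s -> sorted <=%O (insert a s).
Proof.
rewrite !(sorted_pairwise le_trans).
elim: s a => //= b s IH a /andP[bs ss]; rewrite IH // andbT.
apply: insert_ge; first by rewrite leIx2 // lexUl.
by apply: sub_all bs => c bc; rewrite leIx2 // bc orbT.
Qed.

Lemma sorted_straighten u : sorted <=%O (straighten u).
Proof. by elim: u => //= a u IH; apply: sorted_insert. Qed.

End Straightening.

(** * Coordinates of lattice elements under condition (C) *)

Section Coordinates.
Variables (k : fieldType) (disp : Order.disp_t) (A : algType k).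
Variables (Pi : finDistrLatticeType disp) (x : Pi -> A).
Variables (d : nat) (iota : Pi -> d.-tupleprod nat).
Hypothesis HC : condition_C_for x iota.

Lemma coord_le a b i : (a <= b)%O -> tnth (iota a) i <= tnth (iota b) i.
Proof.
rewrite leEmeet => /eqP/(congr1 iota); rewrite (C_meet HC) => /eqP.
by rewrite -leEmeet leEtprod => /forallP/(_ i).
Qed.

(** In one coordinate, meet and join are the minimum and maximum of two numbers, so the pair of
    values is only permuted and [g] can be arbitrary. *)
Lemma coord_modular (g : nat -> nat) i : modular (fun a => g (tnth (iota a) i)).
Proof.
move=> a b /=; rewrite (C_meet HC) (C_join HC) Order.TupleProdOrder.tnth_meet.
rewrite Order.TupleProdOrder.tnth_join meetEtotal joinEtotal /Order.min /Order.max.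
by case: ifP => // _; rewrite addnC.
Qed.

Lemma moment_modular : modular (fun a => moment (iota a)).
Proof.
move=> a b; rewrite /moment !size_tuple !big_mkord -!big_split /=.
apply: eq_bigr => i _; rewrite -!mulnDr -!tnth_nth; congr (_ * _).
exact: (coord_modular id).
Qed.

(** As [a] and [b] may be incomparable, [moment_spread] is applied to the chain formed by [l], the
    meet, the join and [m]; modularity transfers both the weight and the multiset of coordinates
    from [a], [b] to their meet and join. *)
Lemma moment_lt a b p : encloses a b p ->
  perm_eq (iota a ++ iota b) (iota p.1 ++ iota p.2) ->
  p <> ((a `&` b)%O, (a `|` b)%O) ->
  moment (iota p.1) + moment (iota p.2) < moment (iota a) + moment (iota b).
Proof.
case: p => l m /and4P[/= la lb am bm] ab_lm neq; rewrite -(moment_modular a b).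
have meet_join : perm_eq (iota (a `&` b)%O ++ iota (a `|` b)%O) (iota l ++ iota m).
  apply: perm_trans ab_lm; apply/permP => P.
  rewrite !count_cat -!sum1_count !big_tuple !(big_mkcond (fun i => P _)) -!big_split.
  by apply: eq_bigr => i _; apply: (coord_modular (fun v => if P v then 1 else 0)).
have coord c c' : (c <= c')%O -> forall i, tnth (iota c) i <= tnth (iota c') i.
  by move=> cc' i; apply: coord_le.
have lI : (l <= a `&` b)%O by rewrite lexI !ltW.
have IU : (a `&` b <= a `|` b)%O by rewrite leIx2 // lexUl.
have Um : (a `|` b <= m)%O by rewrite leUx !ltW.
have [[el em]|//] := moment_spread (C_increasing HC l) (C_increasing HC _)
  (C_increasing HC _) (C_increasing HC m) (coord _ _ lI) (coord _ _ IU)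
  (coord _ _ Um) meet_join.
by case: neq; congr pair; apply: (C_injective HC).
Qed.

(** Along a sorted word each coordinate is a sorted list of numbers, hence determined by its
    multiset of values; injectivity of [iota] then recovers the letters. *)
Lemma eq_sorted_weights (s t : seq Pi) : 0 < d ->
  sorted <=%O s -> sorted <=%O t ->
  (forall i a, weight (fun b => tnth (iota b) i == tnth (iota a) i) s =
               weight (fun b => tnth (iota b) i == tnth (iota a) i) t) ->
  s = t.
Proof.
move=> d0 ss st eq_w.
have eq_i i : [seq tnth (iota a) i | a <- s] = [seq tnth (iota a) i | a <- t].
  have srt u : sorted <=%O u -> sorted leq [seq tnth (iota a) i | a <- u].
    by apply: homo_sorted => a b; apply: coord_le.
  apply: (sorted_eq leq_trans anti_leq) (srt _ ss) (srt _ st) _.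
  apply/allP => v; rewrite -map_cat => /mapP[a _ ->] /=.
  by rewrite -!sum1_count !big_map !(big_mkcond (fun _ => _ == _)) /=; apply/eqP/eq_w.
(* Some coordinate exists because [0 < d], and it detects the length. *)
have size_st : size s = size t.
  by have := congr1 size (eq_i (Ordinal d0)); rewrite !size_map.
case: s ss eq_w eq_i size_st => [|a s] ss eq_w eq_i size_st.
  by apply/esym/size0nil.
apply: (@eq_from_nth _ a) => // n n_lt; apply: (C_injective HC).
apply: eq_from_tnth => i; have := congr1 (nth 0 ^~ n) (eq_i i).
by rewrite !(nth_map a) -?size_st.
Qed.

End Coordinates.

Local Open Scope ring_scope.

(** * Words in an algebra *)

Section Evaluation.
Variables (k : fieldType) (I : choiceType) (B : algType k) (y : I -> B).
Implicit Types (g h : free_algebra k I) (u v : seq I) (P : pred (seq I)).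

Definition word u : free_algebra k I := mamonom u (1 : k^o).

Definition eval g : B :=
  \sum_(u <- msupp g) (macoef u g : k) *: \prod_(a <- u) y a.

Lemma evalE (d : {fset seq I}) g : (msupp g `<=` d)%fset ->
  eval g = \sum_(u <- d) (macoef u g : k) *: \prod_(a <- u) y a.
Proof.
move=> gd; apply: big_fset_incl => // u _ gu.
by rewrite macoef_outdom // scale0r.
Qed.

Lemma eval_is_zmod_morphism : zmod_morphism eval.
Proof.
move=> g h; pose d := (msupp g `|` msupp h `|` msupp (g - h)%R)%fset.
rewrite (@evalE d (g - h)) ?(@evalE d g) ?(@evalE d h).
- by rewrite -sumrB; apply: eq_bigr => u _; rewrite raddfB scalerBl.
- by rewrite /d -fsetUA fsetUCA fsubsetUl.
- by rewrite /d -fsetUA fsubsetUl.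
- by rewrite fsubsetUr.
Qed.
HB.instance Definition _ := GRing.isZmodMorphism.Build (free_algebra k I) B eval
  eval_is_zmod_morphism.

Lemma eval_monom u (c : k) : eval (mamonom u (c : k^o)) = c *: \prod_(a <- u) y a.
Proof.
rewrite (@evalE [fset u]%fset) ?msuppU_le // big_seq_fset1.
by rewrite macoef_monom eqxx.
Qed.

Lemma eval_word u : eval (word u) = \prod_(a <- u) y a.
Proof. by rewrite eval_monom scale1r. Qed.

Lemma eval_is_scalable : scalable eval.
Proof.
move=> c g; rewrite [g in LHS]maE scaler_sumr raddf_sum [RHS]scaler_sumr.
by apply: eq_bigr => u _; rewrite mascale_monom [LHS]eval_monom scalerA.
Qed.
HB.instance Definition _ := GRing.isScalable.Build k (free_algebra k I) B *:%R eval
  eval_is_scalable.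

Lemma eval_is_monoid_morphism : monoid_morphism eval.
Proof.
split=> [|g h]; first by rewrite [LHS]eval_monom big_nil scale1r.
rewrite [g in LHS]maE [h in LHS]maE mulr_suml raddf_sum mulr_suml.
apply: eq_bigr => u _; rewrite mulr_sumr raddf_sum mulr_sumr.
apply: eq_bigr => v _; rewrite -[*%R]/(@mamul _ _ _ _ _) mamul_monom [LHS]eval_monom.
by rewrite big_cat -scalerAl -scalerAr scalerA.
Qed.
HB.instance Definition _ := GRing.isMonoidMorphism.Build (free_algebra k I) B eval
  eval_is_monoid_morphism.

Definition supported P g : Prop := forall u, macoef u g != 0 -> P u.

Lemma supported_submod P : supported P 0 /\
  forall (c : k) g h, supported P g -> supported P h -> supported P (c *: g + h).
Proof.
split=> [u|c g h Pg Ph u]; first by rewrite macoef0 eqxx.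
apply: contraNT => Pu; rewrite macoefD macoefZ.
have [->|/Pg] := eqVneq (macoef u g) 0; last by rewrite (negPf Pu).
have [->|/Ph] := eqVneq (macoef u h) 0; last by rewrite (negPf Pu).
by rewrite scaler0 addr0.
Qed.

Lemma supportedZ P (c : k) g : supported P g -> supported P (c *: g).
Proof.
move=> Pg; have [P0 PD] := supported_submod P.
by rewrite -[_ *: _]addr0; apply: PD.
Qed.

Lemma supportedD P g h : supported P g -> supported P h -> supported P (g + h).
Proof. by rewrite -{2}[g]scale1r; case: (supported_submod P) => _; apply. Qed.

Lemma supported_sum P (T : eqType) (r : seq T) (f : T -> free_algebra k I) :
  (forall t, t \in r -> supported P (f t)) -> supported P (\sum_(t <- r) f t).
Proof.
move=> Pf; rewrite big_seq; apply: (big_ind (supported P)) => //.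
- by case: (supported_submod P).
- exact: supportedD.
Qed.

Lemma supported_word P u : P u -> supported P (word u).
Proof.
by move=> Pu v; rewrite macoef_monom; case: (eqVneq u v) => [<-|_] //; rewrite eqxx.
Qed.

Lemma sub_supported P Q g : subpred P Q -> supported P g -> supported Q g.
Proof. by move=> PQ Pg u /Pg/PQ. Qed.

(** Membership is witnessed in the free algebra, so that the coefficients of a representation can be
    read off. *)
Definition word_span P : {pred B} :=
  fun b => `[< exists g, supported P g /\ eval g = b >].

Lemma word_spanP P b :
  reflect (exists g, supported P g /\ eval g = b) (b \in word_span P).
Proof. exact: asboolP. Qed.

Lemma word_span_submod P : submod_closed (word_span P).
Proof.
have [P0 PD] := supported_submod P.
split=> [|c a b /word_spanP[g [Pg <-]] /word_spanP[h [Ph <-]]]; apply/word_spanP.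
  by exists 0; rewrite raddf0.
by exists (c *: g + h); split; [exact: PD | exact: linearP].
Qed.

Lemma mem_word_span P u : P u -> \prod_(a <- u) y a \in word_span P.
Proof.
move=> Pu; apply/word_spanP; exists (word u).
by rewrite eval_word; split=> //; apply: supported_word.
Qed.

Lemma sub_word_span P Q : subpred P Q -> {subset word_span P <= word_span Q}.
Proof.
move=> PQ b /word_spanP[g [Pg <-]]; apply/word_spanP; exists g; split=> //.
exact: sub_supported Pg.
Qed.

Lemma word_span_ind P (V : {pred B}) : submod_closed V ->
  (forall u, P u -> \prod_(a <- u) y a \in V) -> {subset word_span P <= V}.
Proof.
case=> V0 VD PV b /word_spanP[g [Pg <-]]; rewrite /eval big_seq.
apply: (big_ind (fun b => b \in V)) => // [a c Va|u].
  by rewrite -[a]scale1r; apply: VD.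
rewrite -mcoeff_neq0 => /Pg/PV Vu.
by rewrite -[_ *: _]addr0; apply: VD.
Qed.

Lemma word_spanM (P Q R : pred (seq I)) :
  (forall u v, P u -> Q v -> R (u ++ v)) ->
  forall a b, a \in word_span P -> b \in word_span Q -> a * b \in word_span R.
Proof.
move=> PQR a b Pa Qb; have [R0 RD] := word_span_submod R.
pose V : {pred B} := fun b' => a * b' \in word_span R.
apply: (word_span_ind (V := V)) Qb => [|v Qv].
  split=> [|c b1 b2 Vb1 Vb2]; rewrite /V -topredE /= ?mulr0 //.
  by rewrite mulrDr -scalerAr; apply: RD.
pose W : {pred B} := fun a' => a' * \prod_(i <- v) y i \in word_span R.
apply: (word_span_ind (V := W)) Pa => [|u Pu].
  split=> [|c a1 a2 Wa1 Wa2]; rewrite /W -topredE /= ?mul0r //.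
  by rewrite mulrDl -scalerAl; apply: RD.
by rewrite /W -topredE /= -big_cat; apply/mem_word_span/PQR.
Qed.

Lemma word_span_full b :
  (forall S : {pred B}, subalg_closed S -> (forall a, y a \in S) -> forall b, b \in S) ->
  b \in word_span predT.
Proof.
apply=> [|a].
  have [T0 TD] := word_span_submod predT; split; last exact: word_spanM.
    by have := @mem_word_span predT [::] isT; rewrite big_nil.
  by move=> c a b' Ta Tb; apply: TD.
by have := @mem_word_span predT [:: a] isT; rewrite big_seq1.
Qed.

End Evaluation.

(** * Morphisms out of a quotient algebra *)

Section QuotientLift.
Variables (k : fieldType) (A B : algType k) (J : ideal2 A) (f : {lrmorphism A -> B}).

(* The argument fJ makes the morphism structure inferable. *)
Definition quotient_lift (fJ : forall u, u \in ideal2_pred J -> f u = 0)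
  (u : quotient_algebra J) : B := f (repr u).

Hypothesis fJ : forall u, u \in ideal2_pred J -> f u = 0.

Lemma quotient_liftE u : (quotient_lift fJ) (quotient_pi J u) = f u.
Proof.
by apply/esym/eqP; rewrite -subr_eq0 -rmorphB; apply/eqP/fJ/subr_repr.
Qed.

Lemma quotient_pi_surj (u : quotient_algebra J) : exists v, u = quotient_pi J v.
Proof. by exists (repr u); rewrite /quotient_pi reprK. Qed.

Lemma quotient_lift_is_zmod_morphism : zmod_morphism (quotient_lift fJ).
Proof.
move=> u v; have [[a ->] [b ->]] := (quotient_pi_surj u, quotient_pi_surj v).
by rewrite -raddfB !quotient_liftE raddfB.
Qed.
HB.instance Definition _ := GRing.isZmodMorphism.Build (quotient_algebra J) B
  (quotient_lift fJ) quotient_lift_is_zmod_morphism.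

Lemma quotient_lift_is_monoid_morphism : monoid_morphism (quotient_lift fJ).
Proof.
split=> [|u v]; first by rewrite -(rmorph1 (quotient_pi J)) quotient_liftE rmorph1.
have [[a ->] [b ->]] := (quotient_pi_surj u, quotient_pi_surj v).
by rewrite -rmorphM !quotient_liftE rmorphM.
Qed.
HB.instance Definition _ := GRing.isMonoidMorphism.Build (quotient_algebra J) B
  (quotient_lift fJ) quotient_lift_is_monoid_morphism.

Lemma quotient_lift_is_scalable : scalable (quotient_lift fJ).
Proof.
by move=> c u; have [a ->] := quotient_pi_surj u; rewrite -linearZ !quotient_liftE linearZ.
Qed.
HB.instance Definition _ := GRing.isScalable.Build k (quotient_algebra J) B *:%R
  (quotient_lift fJ) quotient_lift_is_scalable.

End QuotientLift.

(** The universal property yields a morphism out of the toric algebra, while the isomorphism is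
    wanted in the opposite direction. *)
Lemma isomorphic_algebras_sym (k : fieldType) (B C : algType k)
  (f : {lrmorphism B -> C}) : injective f -> (forall c, exists b, f b = c) ->
  isomorphic_algebras C B.
Proof.
move=> fI /choice[g gK].
have fK : cancel f g by move=> b; apply: fI.
have gZ : zmod_morphism g by move=> a b; apply: fI; rewrite gK [RHS]rmorphB /= !gK.
have gM : monoid_morphism g.
  by split=> [|a b]; apply: fI; rewrite gK ?[RHS]rmorph1 // [RHS]rmorphM /= !gK.
have gS : scalable g by move=> c a; apply: fI; rewrite gK [RHS]linearZ /= !gK.
pose Ga := GRing.isZmodMorphism.Build C B g gZ.
pose Gm := GRing.isMonoidMorphism.Build C B g gM.
pose Gs := GRing.isScalable.Build k C B *:%R g gS.
pose G : {lrmorphism C -> B} := HB.pack g Ga Gm Gs.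
by exists G; exists f.
Qed.

(** * Homogeneous classes of the associated graded algebra *)

Lemma quotient_pi_eq0 (k : fieldType) (A : algType k) (J : ideal2 A) (u : A) :
  (quotient_pi J u = 0) <-> (u \in ideal2_pred J).
Proof.
rewrite -[X in _ = X](raddf0 (quotient_pi J)); split=> [/quotientP|uJ].
  by rewrite subr0.
by apply/quotientP; rewrite subr0.
Qed.

Section GradedClasses.
Variables (k : fieldType) (A : algType k) (F : filtration A).
Implicit Types (i j : int) (a b : A).

(** For [a] in [F i] this is the monomial a t^i of the Rees algebra; the default 0 is taken for
    other [a]. *)
Definition rees_monom i a : rees F := insubd (0 : rees F) (mamonom i a : laurent A).

Definition gr_class i a : associated_graded F := quotient_pi (gr_ideal F) (rees_monom i a).

Lemma val_rees_monom i a : a \in F i -> val (rees_monom i a) = mamonom i a.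
Proof.
move=> Fa; rewrite val_insubd.
suff -> : mamonom i a \in in_shift F 0 by [].
apply/in_shiftP => j; rewrite macoef_monom subr0.
by case: (eqVneq i j) => [<-|_] //; case: (filt_submod F j).
Qed.

Lemma gr_classD i (c : k) a b : a \in F i -> b \in F i ->
  gr_class i (c *: a + b) = c *: gr_class i a + gr_class i b.
Proof.
move=> Fa Fb; rewrite /gr_class -[RHS]linearP; congr (quotient_pi _ _).
apply: val_inj; rewrite [RHS]linearP /= !val_rees_monom //.
  by rewrite [LHS]raddfD /= mascale_monom.
by case: (filt_submod F i) => _; apply.
Qed.

Lemma gr_class0 i : gr_class i 0 = 0.
Proof.
have F0 : 0 \in F i by case: (filt_submod F i).
have := gr_classD (-1) F0 F0.
by rewrite scaler0 addr0 scaleN1r addNr.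
Qed.

Lemma gr_classZ i (c : k) a : a \in F i -> gr_class i (c *: a) = c *: gr_class i a.
Proof.
have F0 : 0 \in F i by case: (filt_submod F i).
by move=> Fa; rewrite -[_ *: _]addr0 gr_classD // gr_class0 addr0.
Qed.

Lemma gr_classM i j a b : a \in F i -> b \in F j ->
  gr_class i a * gr_class j b = gr_class (i + j) (a * b).
Proof.
move=> Fa Fb; rewrite /gr_class -[LHS]rmorphM; congr (quotient_pi _ _).
apply: val_inj; rewrite [LHS]rmorphM /= !val_rees_monom ?filtM //.
exact: mamul_monom.
Qed.

(** The quotients F_i / F_(i-1) form a direct sum: a relation holds degree by degree because the
    ideal is cut out by a condition on each Laurent coefficient. *)
Lemma gr_class_sum_eq0 (T : eqType) (r : seq T) (d : T -> int) (f : T -> A) :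
  (forall t, t \in r -> f t \in F (d t)) ->
  \sum_(t <- r) gr_class (d t) (f t) = 0 ->
  forall i, \sum_(t <- r | d t == i) f t \in F (i - 1).
Proof.
move=> Ff; rewrite -(raddf_sum (quotient_pi _)) => /quotient_pi_eq0.
move=> /in_shiftP r0 i.
suff -> : \sum_(t <- r | d t == i) f t = macoef i (val (\sum_(t <- r) rees_monom (d t) (f t))).
  exact: r0.
rewrite (raddf_sum val) (raddf_sum (macoef i)) big_mkcond; apply: eq_big_seq => t rt /=.
by rewrite val_rees_monom ?Ff // macoef_monom; case: eqP.
Qed.

Lemma gr_class_eq0 i a : a \in F (i - 1) -> gr_class i a = 0.
Proof.
move=> Fa; apply/quotient_pi_eq0/in_shiftP => j.
rewrite val_rees_monom ?macoef_monom; last first.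
  by apply: filt_ascending Fa; rewrite Num.Theory.gerBl.
by case: eqVneq => [<-//|_]; case: (filt_submod F (j - 1)).
Qed.

Lemma gr_class_eq i a b : a \in F i -> b \in F i ->
  a - b \in F (i - 1) <-> gr_class i a = gr_class i b.
Proof.
move=> Fa Fb; have -> : a - b = (-1) *: b + a by rewrite scaleN1r addrC.
have eq_class : gr_class i ((-1) *: b + a) = gr_class i a - gr_class i b.
  by rewrite gr_classD // scaleN1r addrC.
split=> [/gr_class_eq0|ab]; first by rewrite eq_class => /subr0_eq.
have := @gr_class_sum_eq0 unit [:: tt] (fun=> i) (fun=> (-1) *: b + a).
rewrite big_seq1 eq_class ab subrr => /(_ _ (erefl _) i).
rewrite big_mkcond big_seq1 eqxx; apply=> t _.
by case: (filt_submod F i) => _; apply.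
Qed.

(** An element of the Rees algebra is the finite sum of its monomials. *)
Lemma gr_class_ind (V : {pred associated_graded F}) :
  (forall z z', z \in V -> z' \in V -> z + z' \in V) ->
  (forall i a, a \in F i -> gr_class i a \in V) -> forall z, z \in V.
Proof.
move=> VD Vcl z; have [g ->] := quotient_pi_surj z.
have Fg i : macoef i (val g) \in F i.
  by have /in_shiftP/(_ i) := valP g; rewrite subr0.
have -> : g = \sum_(i <- msupp (val g)) rees_monom i (macoef i (val g)).
  apply: val_inj; rewrite (raddf_sum val) [LHS]maE.
  by apply: eq_bigr => i _; rewrite /= val_rees_monom.
rewrite raddf_sum; apply: (big_ind (fun z => z \in V)) => // [|i _]; last exact: Vcl.
rewrite -(gr_class0 0); apply: Vcl.
by case: (filt_submod F 0).
Qed.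

End GradedClasses.

(** * Quantum toric relations *)

Lemma gr_class1 (k : fieldType) (A : algType k) (F : filtration A) :
  gr_class F 0 1 = 1.
Proof.
rewrite /gr_class -[RHS](rmorph1 (quotient_pi _)); congr (quotient_pi _ _).
by apply: val_inj; rewrite val_rees_monom // filt1.
Qed.

(** Independence is used in this form: [eval] is injective on combinations of sorted words. *)
Lemma independent_eval (k : fieldType) (disp : Order.disp_t) (Pi : finPOrderType disp)
    (B : algType k) (y : Pi -> B) (g : free_algebra k Pi) :
  standard_monomials_independent y -> supported (sorted <=%O) g -> eval y g = 0 ->
  g = 0.
Proof.
move=> ind sg g0; apply: maP => u; rewrite macoef0.
have [u_g|/macoef_outdom //] := boolP (u \in msupp g).
apply: (ind (msupp g) (fun v => macoef v g)) u_g => // [|v]; first exact: fset_uniq.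
by rewrite -mcoeff_neq0 => /sg.
Qed.

Section ToricRelations.
Variables (k : fieldType) (disp : Order.disp_t) (Pi : finDistrLatticeType disp).
Variables (q c : Pi -> Pi -> k).
Hypotheses (q0 : forall a b, q a b != 0) (c0 : forall a b, (a >< b)%O -> c a b != 0).

Definition toric_relations (B : algType k) (y : Pi -> B) : Prop :=
  (forall a b, y a * y b = q a b *: (y b * y a)) /\
  (forall a b, (a >< b)%O -> y a * y b = c a b *: (y (a `&` b)%O * y (a `|` b)%O)).

Section Words.
Variables (B : algType k) (y : Pi -> B).
Hypothesis Hy : toric_relations y.

(** If a <= b the two sides agree already, if b <= a the [q] relation applies, and otherwise the [c]
    relation; one rule thus serves every step of [insert]. *)
Lemma toric_swap a b :
  exists2 z, z != 0 & y a * y b = z *: (y (a `&` b)%O * y (a `|` b)%O).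
Proof.
have [/orP[ab|ba]|ab] := boolP (a >=< b)%O.
- by exists 1; [exact: oner_neq0 | rewrite (meet_l ab) (join_r ab) scale1r].
- by exists (q a b); [exact: q0 | rewrite (meet_r ba) (join_l ba) Hy.1].
- by exists (c a b); [exact: c0 | exact: Hy.2].
Qed.

Lemma toric_insert a u : exists2 z, z != 0 &
  y a * \prod_(b <- u) y b = z *: \prod_(b <- insert a u) y b.
Proof.
elim: u a => [|b u IH] a /=.
  by exists 1; [exact: oner_neq0 | rewrite big_nil big_seq1 mulr1 scale1r].
have [z1 z10 D1] := toric_swap a b; have [z2 z20 D2] := IH (a `|` b)%O.
exists (z1 * z2); first by rewrite mulf_neq0.
by rewrite !big_cons mulrA D1 -scalerAl -mulrA D2 -scalerAr scalerA.
Qed.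

Lemma toric_straighten u : exists2 z, z != 0 &
  \prod_(b <- u) y b = z *: \prod_(b <- straighten u) y b.
Proof.
elim: u => [|a u [z1 z10 D1]] /=; first by exists 1; [exact: oner_neq0 | rewrite scale1r].
have [z2 z20 D2] := toric_insert a (straighten u).
exists (z1 * z2); first by rewrite mulf_neq0.
by rewrite big_cons D1 -scalerAr D2 scalerA.
Qed.

Lemma toric_word_span b : b \in word_span y predT -> b \in word_span y (sorted <=%O).
Proof.
have V := word_span_submod y (sorted <=%O).
apply: word_span_ind => // u _; have [z _ ->] := toric_straighten u.
by rewrite -[_ *: _]addr0 V.2 ?V.1 // mem_word_span // sorted_straighten.
Qed.

Lemma toric_ideal_eval (g : free_algebra k Pi) :
  g \in ideal2_pred (toric_ideal q c) -> eval y g = 0.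
Proof.
have gen a : eval y (free_gen k a) = y a by rewrite [LHS]eval_monom scale1r big_seq1.
move=> /generated_idealP[s [Ss ->]]; rewrite raddf_sum big_seq big1 // => t /Ss St.
rewrite [LHS]rmorphM [X in X * _]rmorphM /=.
suff -> : eval y t.1.2 = 0 by rewrite mulr0 mul0r.
case: St => [[a [b ->]]|[a [b [ab ->]]]]; rewrite [LHS]raddfB /=.
  by rewrite [X in _ - X]linearZ /= !rmorphM /= !gen Hy.1 subrr.
by rewrite [X in _ - X]linearZ /= !rmorphM /= !gen Hy.2 // subrr.
Qed.

End Words.

Lemma toric_gen_relations : toric_relations (toric_gen q c).
Proof.
split=> a b => [|ab]; apply/eqP; rewrite -subr_eq0; apply/eqP;
  rewrite /toric_gen -!rmorphM -linearZ -raddfB; apply/quotient_pi_eq0/generated_idealP.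
  exists [:: (1, free_gen k a * free_gen k b - q a b *: (free_gen k b * free_gen k a), 1)].
  rewrite big_seq1 mul1r mulr1; split=> // t; rewrite inE => /eqP -> /=.
  by left; exists a, b.
exists [:: (1, free_gen k a * free_gen k b -
  c a b *: (free_gen k (a `&` b)%O * free_gen k (a `|` b)%O), 1)].
rewrite big_seq1 mul1r mulr1; split=> // t; rewrite inE => /eqP -> /=.
by right; exists a, b.
Qed.

Lemma toric_gen_span (b : quantum_toric q c) : b \in word_span (toric_gen q c) predT.
Proof.
have [g ->] := quotient_pi_surj b; apply/word_spanP; exists g; split=> //.
rewrite [in RHS](maE g) raddf_sum; apply: eq_bigr => u _.
(* Each coefficient, an element of [k^o], is written as a multiple of 1 to separate it from its
   word. *)
rewrite -[macoef u g in RHS]mulr1 -[_ * 1]/((macoef u g : k) *: (1 : k^o)).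
rewrite -mascale_monom [RHS]linearZ; congr (_ *: _).
elim: u => [|a u IH]; first by rewrite big_nil -[RHS](rmorph1 (quotient_pi _)).
rewrite big_cons IH -[LHS]rmorphM; congr (quotient_pi _ _).
by rewrite -[*%R]/(@mamul _ _ _ _ _) mamul_monom mulr1.
Qed.

(** The universal property gives a surjection [h] from the toric algebra onto [B]. Sorted words span
    its source and have independent images, so [h] is injective, and independence pulls back along
    [h]. *)
Lemma toric_isomorphism (B : algType k) (y : Pi -> B) : toric_relations y ->
  (forall b, b \in word_span y predT) -> standard_monomials_independent y ->
  isomorphic_algebras B (quantum_toric q c) /\
  standard_monomials_independent (toric_gen q c).
Proof.
move=> Hy y_span y_ind.
pose h : {lrmorphism quantum_toric q c -> B} := quotient_lift (toric_ideal_eval Hy).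
have h_gen a : h (toric_gen q c a) = y a.
  by rewrite [LHS]quotient_liftE [LHS]eval_monom scale1r big_seq1.
have h_mon u : h (\prod_(a <- u) toric_gen q c a) = \prod_(a <- u) y a.
  by rewrite rmorph_prod; apply: eq_bigr => a _; apply: h_gen.
split; last first.
  move=> S e S_uniq S_sorted /(congr1 h); rewrite raddf0 raddf_sum => S0.
  apply: y_ind => //; rewrite -[RHS]S0; apply: eq_bigr => s _.
  by rewrite [RHS]linearZ; congr (_ *: _); rewrite [RHS]h_mon.
apply: (@isomorphic_algebras_sym _ _ _ h) => [|b].
  apply: raddf_inj => z hz.
  have /word_spanP[g [sg gz]] := toric_word_span toric_gen_relations (toric_gen_span z).
  suff g0 : g = 0 by rewrite -gz g0 raddf0.
  apply: independent_eval y_ind sg _.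
  rewrite -[RHS]hz -gz raddf_sum; apply: eq_bigr => u _.
  by rewrite [RHS]linearZ; congr (_ *: _); rewrite [RHS]h_mon.
have /word_spanP[g [_ <-]] := y_span b; exists (quotient_pi _ g).
exact: quotient_liftE.
Qed.

End ToricRelations.

(** * The weight filtration *)

Section WeightFiltration.
Variables (k : fieldType) (disp : Order.disp_t) (Pi : finDistrLatticeType disp).
Variables (A : algType k) (x : Pi -> A) (w : Pi -> nat).
Hypothesis x_gen : forall S : {pred A}, subalg_closed S ->
  (forall a, x a \in S) -> forall u, u \in S.

Definition weight_le (i : int) : pred (seq Pi) := fun u => (weight w u)%:Z <= i.

Lemma weight_filt_ascending (i j : int) : (i <= j)%O ->
  {subset word_span x (weight_le i) <= word_span x (weight_le j)}.
Proof. by move=> ij; apply: sub_word_span => u /le_trans; apply. Qed.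

Lemma weight_filt1 : 1 \in word_span x (weight_le 0).
Proof.
have : weight_le 0 [::] by rewrite /weight_le /weight big_nil.
by move/(mem_word_span x); rewrite big_nil.
Qed.

Lemma weight_filtM (i j : int) a b : a \in word_span x (weight_le i) ->
  b \in word_span x (weight_le j) -> a * b \in word_span x (weight_le (i + j)).
Proof.
by apply: word_spanM => u v; rewrite /weight_le weight_cat PoszD; apply: Num.Theory.lerD.
Qed.

Lemma weight_filt_exhaustive a : exists i, a \in word_span x (weight_le i).
Proof.
have /word_spanP[g [_ <-]] := word_span_full a x_gen.
exists (\max_(u <- msupp g) weight w u)%:Z; apply/word_spanP; exists g; split=> // u.
by rewrite mcoeff_neq0 /weight_le lez_nat => /leq_bigmax_seq; apply.
Qed.

(** Weights of words are natural numbers. This gives separatedness and the base case of the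
    induction on the filtration degree. *)
Lemma weight_filt_neg (i : int) a : i < 0 -> a \in word_span x (weight_le i) -> a = 0.
Proof.
move=> i0 /word_spanP[g [gi <-]]; rewrite [g in LHS](_ : _ = 0) ?raddf0 //.
apply: maP => u; rewrite macoef0; apply/eqP; apply: contraTT i0 => /gi.
by rewrite -leNgt; apply: le_trans.
Qed.

Definition weight_filtration : filtration A := Filtration
  (fun i => word_span_submod x (weight_le i)) weight_filt_ascending weight_filt1
  weight_filtM weight_filt_exhaustive
  (fun a Fa => weight_filt_neg (Num.Theory.ltrN10 int) (Fa (-1))).

Local Notation F := weight_filtration.

Lemma word_weight_filt u : \prod_(a <- u) x a \in F (weight w u).
Proof. by apply: mem_word_span; apply: lexx. Qed.

Definition gr_gen a : associated_graded F := gr_class F (w a) (x a).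

Lemma gen_weight_filt a : x a \in F (w a).
Proof. by have := word_weight_filt [:: a]; rewrite /weight !big_seq1. Qed.

Lemma gr_gen_prod u : \prod_(a <- u) gr_gen a = gr_class F (weight w u) (\prod_(a <- u) x a).
Proof.
elim: u => [|a u IH]; first by rewrite /weight !big_nil gr_class1.
by rewrite weight_cons !big_cons IH gr_classM ?gen_weight_filt ?word_weight_filt.
Qed.

Lemma gr_gen_span z : z \in word_span gr_gen predT.
Proof.
have [V0 VD] := word_span_submod gr_gen predT.
apply: gr_class_ind z => [z z' Vz|i a]; first by rewrite -[z]scale1r; apply: VD.
(* [V] also records membership in [F i], which additivity of [gr_class] requires. *)
pose V : {pred A} := fun a => (a \in F i) && (gr_class F i a \in word_span gr_gen predT).
suff sub : {subset word_span x (weight_le i) <= V} by case/sub/andP.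
have [F0 FD] := filt_submod F i.
apply: word_span_ind => [|u wu].
  split=> [|e b b' /andP[Fb Vb] /andP[Fb' Vb']]; apply/andP; split=> //.
  - by rewrite gr_class0.
  - exact: FD.
  by rewrite gr_classD //; apply: VD.
have Fu : \prod_(a <- u) x a \in F i by apply: mem_word_span.
apply/andP; split=> //.
have [wi|wi] := eqVneq (weight w u : int) i.
  by rewrite -wi -gr_gen_prod mem_word_span.
(* A word of weight below [i] lies in F_(i-1), so its class in degree [i] vanishes. *)
rewrite gr_class_eq0 //; apply: filt_ascending (word_weight_filt u).
by move: wu wi; rewrite /weight_le; lia.
Qed.

End WeightFiltration.

(** * Degeneration *)

Lemma exists_max_seq (T : eqType) (r : seq T) (f : T -> nat) : r != [::] ->
  exists2 m, m \in r & forall t, t \in r -> (f t <= f m)%N.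
Proof.
elim: r => // a r IH _; have [->|/IH[m mr max_m]] := eqVneq r [::].
  by exists a => [|t]; rewrite inE // => /eqP ->.
have [am|ma] := leqP (f a) (f m).
  by exists m => [|t]; rewrite inE ?mr ?orbT // => /predU1P[->|/max_m].
exists a => [|t]; rewrite inE ?eqxx // => /predU1P[->//|/max_m].
by move/leq_trans; apply; apply: ltnW.
Qed.

(* s0 and t0 have the lexicographically largest values of (f j)_j on R and S. *)
Lemma exists_lex_max (T J : eqType) (f : J -> T -> nat) (r : seq J) (R S : seq T) :
  R != [::] -> S != [::] ->
  exists s0 t0, [/\ s0 \in R, t0 \in S,
    forall j, ohead r = Some j ->
      {in R, forall s, f j s <= f j s0}%N /\ {in S, forall t, f j t <= f j t0}%N &
    forall s t, s \in R -> t \in S ->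
      {in r, forall j, f j s + f j t = f j s0 + f j t0}%N ->
      {in r, forall j, f j s = f j s0 /\ f j t = f j t0}].
Proof.
elim: r R S => [|j r IH] R S R0 S0.
  have [s sR _] := exists_max_seq (fun=> 0%N) R0.
  by have [t tS _] := exists_max_seq (fun=> 0%N) S0; exists s, t; split.
have [m mR max_m] := exists_max_seq (f j) R0.
have [n nS max_n] := exists_max_seq (f j) S0.
have filter_neq0 (Q : seq T) (z : T) : z \in Q -> [seq s <- Q | f j s == f j z] != [::].
  by move=> zQ; rewrite -has_filter; apply/hasP; exists z => /=.
have [s0 [t0 [s0R t0S _ max_st]]] := IH _ _ (filter_neq0 _ _ mR) (filter_neq0 _ _ nS).
move: s0R t0S; rewrite !mem_filter => /andP[/eqP fs0 s0R] /andP[/eqP ft0 t0S].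
exists s0, t0; split=> // [_ [<-]|s t sR tS eq_st]; first by rewrite fs0 ft0.
have := eq_st j (mem_head _ _); have := max_m _ sR; have := max_n _ tS.
rewrite fs0 ft0 => le_t le_s sum_st.
have fs : f j s = f j m by lia.
have ft : f j t = f j n by lia.
move=> i; rewrite inE => /predU1P[->|ir]; first by rewrite fs ft fs0 ft0.
apply: max_st ir; rewrite ?mem_filter ?fs ?ft ?eqxx // => l lr.
by apply: eq_st; rewrite inE lr orbT.
Qed.

Section Degeneration.
Variables (k : fieldType) (disp : Order.disp_t) (Pi : finDistrLatticeType disp).
Variables (A : algType k) (x : Pi -> A) (w : Pi -> nat) (q c : Pi -> Pi -> k).
Hypothesis x_gen : forall S : {pred A}, subalg_closed S ->
  (forall a, x a \in S) -> forall u, u \in S.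
Hypothesis x_ind : standard_monomials_independent x.
Hypothesis w_mod : modular w.
Hypotheses (q0 : forall a b, q a b != 0) (c0 : forall a b, (a >< b)%O -> c a b != 0).

Local Notation F := (weight_filtration w x_gen).
Local Notation y := (gr_gen w x_gen).

Hypothesis xq : forall a b,
  x a * x b - q a b *: (x b * x a) \in F ((w a + w b)%N%:Z - 1).
Hypothesis xc : forall a b, (a >< b)%O ->
  x a * x b - c a b *: (x (a `&` b)%O * x (a `|` b)%O) \in F ((w a + w b)%N%:Z - 1).

Lemma filtZ i (z : k) a : a \in F i -> z *: a \in F i.
Proof. by have [F0 FD] := filt_submod F i; rewrite -[_ *: a]addr0 => Fa; apply: FD. Qed.

Lemma gr_gen2 a b : y a * y b = gr_class F (w a + w b)%N (x a * x b).
Proof. by rewrite gr_classM // gen_weight_filt. Qed.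

Lemma gen2_weight_filt a b : x a * x b \in F (w a + w b)%N.
Proof. by rewrite PoszD; apply: filtM; apply: gen_weight_filt. Qed.

(** Modularity of [w] puts both sides of the [c] relation in the same degree, and [xq], [xc] bound
    the differences by a lower degree. *)
Lemma gr_gen_relations : toric_relations q c y.
Proof.
split=> a b => [|ab]; rewrite !gr_gen2.
  have Fba : x b * x a \in F (w a + w b)%N by rewrite addnC gen2_weight_filt.
  rewrite [(w b + w a)%N]addnC -gr_classZ //; apply/gr_class_eq => //.
  - exact: gen2_weight_filt.
  - exact: filtZ.
have Fmj : x (a `&` b)%O * x (a `|` b)%O \in F (w a + w b)%N.
  by rewrite -w_mod gen2_weight_filt.
rewrite w_mod -gr_classZ //; apply/gr_class_eq; last exact: xc.
- exact: gen2_weight_filt.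
- exact: filtZ.
Qed.

(** Equality of classes after toric straightening in the graded algebra means, back in [A], a
    difference of smaller weight. *)
Lemma straighten_mod u : exists2 z, z != 0 &
  \prod_(a <- u) x a - z *: \prod_(a <- straighten u) x a \in F ((weight w u)%:Z - 1).
Proof.
have [z z0] := toric_straighten q0 c0 gr_gen_relations u.
have Fs : \prod_(a <- straighten u) x a \in F (weight w u).
  by rewrite -(weight_straighten u w_mod) word_weight_filt.
rewrite !gr_gen_prod weight_straighten // -gr_classZ // => eq_z; exists z => //.
by apply/gr_class_eq => //; [apply: word_weight_filt | apply: filtZ].
Qed.

Definition sorted_le (i : int) : pred (seq Pi) :=
  fun u => sorted <=%O u && weight_le w i u.

(** Straightening a word leaves a remainder of strictly smaller degree, and the recursion stops
    because F_i = 0 for negative i. *)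
Lemma filt_sorted_span i a : a \in F i -> a \in word_span x (sorted_le i).
Proof.
have [n] : exists n : nat, i < n by exists `|i|.+1; lia.
elim: n i a => [|n IH] i a.
  by move=> i0 /(weight_filt_neg i0) ->; case: (word_span_submod x (sorted_le i)).
move=> i_n; have [V0 VD] := word_span_submod x (sorted_le i).
apply: word_span_ind => // u wu; have [z _ uz] := straighten_mod u.
rewrite -[\prod_(a <- u) x a](subrKC (z *: \prod_(a <- straighten u) x a)).
apply: VD; first apply: mem_word_span.
  by rewrite /sorted_le sorted_straighten /weight_le weight_straighten.
move: wu; rewrite /weight_le => wu.
have lt_n : (weight w u)%:Z - 1 < n by lia.
apply: sub_word_span (IH _ _ lt_n uz) => v /andP[sv].
by rewrite /sorted_le sv /weight_le; lia.
Qed.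

(** The part of a relation in the degree of [s] lifts to a combination [h] of standard words whose
    value lies one step lower in [F], hence is also that of a combination [g] of standard words of
    smaller weight. Independence in [A] forces [h = g], and [s] does not occur in [g]. *)
Lemma gr_gen_independent : standard_monomials_independent y.
Proof.
move=> S e S_uniq S_sorted S0 s sS.
have Sw : \sum_(t <- S | (weight w t)%:Z == (weight w s)%:Z) e t *: \prod_(a <- t) x a
    \in F ((weight w s)%:Z - 1).
  apply: (gr_class_sum_eq0 (d := fun t => (weight w t)%:Z)) => [t _|].
    exact/filtZ/word_weight_filt.
  rewrite -[RHS]S0; apply: eq_bigr => t _.
  by rewrite gr_classZ ?word_weight_filt // /standard_monomial gr_gen_prod.
have /word_spanP[g [sg gE]] := filt_sorted_span Sw.
pose h : free_algebra k Pi :=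
  \sum_(t <- S | (weight w t)%:Z == (weight w s)%:Z) e t *: word k t.
have sh : supported (sorted <=%O) h.
  rewrite /h big_seq_cond; apply: (big_ind (supported _)) => [||t /andP[/S_sorted ? _]].
  - by case: (supported_submod k (sorted <=%O : pred (seq Pi))).
  - exact: supportedD.
  exact/supportedZ/supported_word.
have hg : h - g = 0.
  apply: (independent_eval x_ind); last first.
    have -> : eval x (h - g) = eval x h - eval x g by apply: raddfB.
    apply/eqP; rewrite gE subr_eq0 raddf_sum; apply/eqP/eq_bigr => t _.
    by rewrite [LHS]linearZ /= [X in _ *: X]eval_word.
  rewrite -scaleN1r; apply: supportedD => //; apply: supportedZ.
  by apply: sub_supported sg => u /andP[].
have : macoef s h = macoef s g by rewrite (subr0_eq hg).
rewrite (_ : macoef s g = 0); last first.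
  by apply/eqP; apply/negPn/negP => /sg/andP[_]; rewrite /weight_le; lia.
rewrite /h raddf_sum big_mkcond (bigD1_seq s) //= eqxx big1 => [|t ts].
  by rewrite macoefZ macoef_monom eqxx addr0 [_ *: _]mulr1.
by case: ifP => // _; rewrite macoefZ macoef_monom (negPf ts) scaler0.
Qed.

Lemma degeneration :
  isomorphic_algebras (associated_graded F) (quantum_toric q c) /\
  standard_monomials_independent (toric_gen q c).
Proof.
apply: toric_isomorphism gr_gen_relations _ gr_gen_independent => //.
exact: gr_gen_span.
Qed.

Lemma straighten_expansion u : exists zg : k * free_algebra k Pi,
  [/\ zg.1 != 0, supported (sorted_le ((weight w u)%:Z - 1)) zg.2 &
      \prod_(a <- u) x a = eval x (zg.1 *: word k (straighten u) + zg.2)].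
Proof.
have [z z0 /filt_sorted_span/word_spanP[g [sg gE]]] := straighten_mod u.
exists (z, g); split=> //=.
have -> : eval x (z *: word k (straighten u) + g) =
  z *: eval x (word k (straighten u)) + eval x g by apply: linearP.
by rewrite gE eval_word addrC subrK.
Qed.

(** * Products of leading terms *)

Variables (J : finType) (f : J -> Pi -> nat).
Hypothesis f_mod : forall j, modular (f j).
Hypothesis f_sep : forall s t, sorted <=%O s -> sorted <=%O t ->
  (forall j, weight (f j) s = weight (f j) t) -> s = t.

Lemma degeneration_domain : is_domain A.
Proof.
split=> [|a b ab0]; first by apply/eqP/oner_neq0.
have sorted_rep z : exists2 g, supported (sorted <=%O) g & eval x g = z.
  have [i /filt_sorted_span/word_spanP[g [sg <-]]] := weight_filt_exhaustive w x_gen z.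
  by exists g => //; apply: sub_supported sg => u /andP[].
have [[g sg ga] [h sh hb]] := (sorted_rep a, sorted_rep b).
have [g0|g_neq0] := eqVneq g 0; first by left; rewrite -ga g0 raddf0.
have [h0|h_neq0] := eqVneq h 0; first by right; rewrite -hb h0 raddf0.
exfalso; have supp_neq0 (e : free_algebra k Pi) : e != 0 -> (msupp e : seq _) != [::].
  by apply: contraNneq => e0; rewrite [e]maE e0 big_nil.
have srt (e : free_algebra k Pi) u :
    supported (sorted <=%O) e -> u \in msupp e -> sorted <=%O u.
  by move=> se; rewrite -mcoeff_neq0 => /se.
(* [None] stands for [w] and heads the list below, so that words are compared by [w] first. *)
pose fw (o : option J) := weight (if o is Some j then f j else w).
have [s0 [t0 [s0g t0h max_w max_st]]] := exists_lex_max fw (None :: [seq Some j | j <- enum J])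
  (supp_neq0 _ g_neq0) (supp_neq0 _ h_neq0).
have {max_w} [max_g max_h] := max_w None (erefl _).
have [N HN] := choice straighten_expansion.
(* The expansion of [a * b] in standard words, which vanishes by independence. *)
pose P : free_algebra k Pi := \sum_(s <- msupp g) \sum_(t <- msupp h)
  ((macoef s g : k) * (macoef t h : k)) *: ((N (s ++ t)).1 *: word k (straighten (s ++ t))
    + (N (s ++ t)).2).
have P0 : P = 0.
  apply: (independent_eval x_ind).
    apply: supported_sum => s _; apply: supported_sum => t _; apply: supportedZ.
    apply: supportedD; first exact/supportedZ/supported_word/sorted_straighten.
    by have [_ + _] := HN (s ++ t); apply: sub_supported => u /andP[].
  rewrite -ab0 -ga -hb /P raddf_sum /eval mulr_suml; apply: eq_bigr => s _.
  rewrite raddf_sum mulr_sumr; apply: eq_bigr => t _.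
  rewrite [LHS]linearZ /=; have [_ _ <-] := HN (s ++ t).
  by rewrite big_cat -scalerAl -scalerAr scalerA.
(* Only the pair [(s0, t0)] contributes to the word [straighten (s0 ++ t0)], and its contribution is
   nonzero. *)
have coef s t : s \in msupp g -> t \in msupp h ->
  macoef (straighten (s0 ++ t0)) (((macoef s g : k) * (macoef t h : k)) *:
    ((N (s ++ t)).1 *: word k (straighten (s ++ t)) + (N (s ++ t)).2)) =
  if (s == s0) && (t == t0) then
    macoef s0 g * macoef t0 h * (N (s0 ++ t0)).1 else 0.
  move=> s_g t_h; have [_ sN _] := HN (s ++ t).
  (* Words of the remainder weigh less than [s ++ t], hence less than [s0 ++ t0] by maximality of
     [w]. *)
  have lower : macoef (straighten (s0 ++ t0)) (N (s ++ t)).2 = 0.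
    apply/eqP; apply/negPn/negP => /sN/andP[_]; rewrite /weight_le.
    rewrite weight_straighten // !weight_cat.
    by have := max_g _ s_g; have := max_h _ t_h; rewrite /fw /=; lia.
  rewrite macoefZ macoefD lower addr0 macoefZ macoef_monom.
  have [/andP[/eqP -> /eqP ->]|st] := ifPn; first by rewrite eqxx scalerA; apply: mulr1.
  case: eqVneq => [eq_st|_]; last by rewrite !scaler0.
  case/negP: st.
  have fw_mod o : modular (if o is Some j then f j else w) by case: o.
  (* Straightening preserves modular weights, so the totals for [s], [t] and for [s0], [t0] agree;
     maximality then makes the weights agree word by word, and [f_sep] identifies the words. *)
  have eq_fw : {in None :: [seq Some j | j <- enum J],
      forall o, fw o s = fw o s0 /\ fw o t = fw o t0}.
    apply: max_st => // o _; rewrite /fw -!weight_cat.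
    by rewrite -(weight_straighten (s ++ t)) // eq_st weight_straighten.
  have eq_f j : weight (f j) s = weight (f j) s0 /\ weight (f j) t = weight (f j) t0.
    by apply: (eq_fw (Some j)); rewrite inE map_f ?orbT ?mem_enum.
  have -> : s = s0.
    by apply: f_sep (srt _ _ sg s_g) (srt _ _ sg s0g) _ => j; case: (eq_f j).
  have -> : t = t0.
    by apply: f_sep (srt _ _ sh t_h) (srt _ _ sh t0h) _ => j; case: (eq_f j).
  by rewrite !eqxx.
have := congr1 (macoef (straighten (s0 ++ t0))) P0.
rewrite macoef0 raddf_sum (bigD1_seq s0) ?fset_uniq //= raddf_sum (bigD1_seq t0) ?fset_uniq //=.
rewrite coef // !eqxx /= big_seq_cond big1 => [|t /andP[th tt]]; last first.
  by rewrite coef // (negPf tt) andbF.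
rewrite big_seq_cond big1 ?addr0 => [|s /andP[s_g ss]]; last first.
  rewrite raddf_sum big_seq big1 // => t th.
  by rewrite /= coef // (negPf ss).
apply/eqP; rewrite !mulf_neq0 ?mcoeff_neq0 //.
by have [] := HN (s0 ++ t0).
Qed.

End Degeneration.

(** [Q] serves two uses: all enclosing pairs of a commutation relation, whose coefficient at the
    meet and join is 0, and the pairs left in a straightening relation once the term in the meet and
    join is removed. *)
Lemma enclosed_sum_weight (k : fieldType) (disp : Order.disp_t)
    (Pi : finDistrLatticeType disp) (A : algType k) (x : Pi -> A) (d : nat)
    (iota : Pi -> d.-tupleprod nat) (a b : Pi) (Q : pred (Pi * Pi)) (e : Pi -> Pi -> k) :
  condition_C_for x iota ->
  (forall p, Q p -> e p.1 p.2 != 0 -> [/\ encloses a b p,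
     perm_eq (iota a ++ iota b) (iota p.1 ++ iota p.2) &
     p <> ((a `&` b)%O, (a `|` b)%O)]) ->
  \sum_(p | Q p) e p.1 p.2 *: (x p.1 * x p.2) \in
    word_span x (weight_le (fun a => moment (iota a))
      ((moment (iota a) + moment (iota b))%N%:Z - 1)).
Proof.
move=> HC He; set V := word_span _ _; have [V0 VD] : submod_closed V := word_span_submod _ _.
apply: (big_ind (fun u => u \in V)) => // [u v Vu|p Qp]; first by rewrite -[u]scale1r; apply: VD.
have [->|ep0] := eqVneq (e p.1 p.2) 0; first by rewrite scale0r.
have [ab_p perm_p neq_p] := He p Qp ep0; rewrite -[_ *: _]addr0; apply: VD => //.
rewrite (_ : x p.1 * x p.2 = \prod_(i <- [:: p.1; p.2]) x i); last by rewrite big_cons big_seq1.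
apply: mem_word_span; rewrite /weight_le /weight big_cons big_seq1.
by have /= := moment_lt HC ab_p perm_p neq_p; lia.
Qed.

Theorem theorem4p9 (k : fieldType) (disp : Order.disp_t)
    (Pi : finDistrLatticeType disp) (A : algType k)
    (gr : nat -> {pred A}) (x : Pi -> A)
    (Hasl : symmetric_quantum_graded_asl x gr) (HC : condition_C x) :
  (exists (q c : Pi -> Pi -> k) (F : filtration A),
     [/\ forall a b, q a b != 0,
         forall a b, (a >< b)%O -> c a b != 0,
         isomorphic_algebras (associated_graded F) (quantum_toric q c) &
         standard_monomials_independent (toric_gen q c)]) /\
  is_domain A.
Proof.
have [d [iota [d_gt0 HCd]]] := HC; pose w a := moment (iota a).
have x_gen := asl_generates Hasl; have x_ind := asl_independent Hasl.
have w_mod : modular w := moment_modular HCd.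
pose lower a b := word_span x (weight_le w ((w a + w b)%N%:Z - 1)).
have /choice[q Hq] : forall p : Pi * Pi, exists z : k,
    z != 0 /\ x p.1 * x p.2 - z *: (x p.2 * x p.1) \in lower p.1 p.2.
  case=> a b; have [z [e [[z0 De] e0 e_perm]]] := C_commutation HCd a b.
  exists z; split=> //=; rewrite De; apply: enclosed_sum_weight HCd _ => p ab_p ep.
  split=> //; first exact: e_perm.
  by move=> Dp; rewrite Dp e0 eqxx in ep.
have /choice[c Hc] : forall p : Pi * Pi, exists z : k, (p.1 >< p.2)%O ->
    z != 0 /\ x p.1 * x p.2 - z *: (x (p.1 `&` p.2)%O * x (p.1 `|` p.2)%O) \in lower p.1 p.2.
  (* On comparable pairs nothing is required, and the value is set to 0. *)
  case=> a b /=; have [_|ab] := boolP (a >=< b)%O; first by exists 0.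
  have [e [-> e0 e_perm]] := C_straightening HCd ab.
  exists (e (a `&` b)%O (a `|` b)%O) => _; split=> //.
  (* Incomparability makes these inequalities strict, so the pair of meet and join is a term of the
     straightening relation. *)
  have ab_mj : encloses a b ((a `&` b)%O, (a `|` b)%O).
    move: ab; rewrite negb_or => /andP[ab ba].
    rewrite /encloses /= !lt_neqAle leIl leIr leUl leUr eq_meetl eq_meetr.
    by rewrite ![_ == (_ `|` _)%O]eq_sym eq_joinl eq_joinr ab ba.
  rewrite (bigD1 _ ab_mj) /= addrAC subrr add0r.
  apply: enclosed_sum_weight HCd _ => p /andP[ab_p /eqP neq_p] ep.
  by split=> //; apply: e_perm.
have q0 a b : q (a, b) != 0 by case: (Hq (a, b)).
have c0 a b : (a >< b)%O -> c (a, b) != 0 by case/(Hc (a, b)).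
have xq a b := (Hq (a, b)).2.
have xc a b (ab : (a >< b)%O) := (Hc (a, b) ab).2.
split.
  exists (fun a b => q (a, b)), (fun a b => c (a, b)), (weight_filtration w x_gen).
  have [iso ind] := degeneration (x_gen := x_gen) x_ind w_mod q0 c0 xq xc.
  by split.
(* On a word, the weight of [coord (i, a)] counts the letters that share the [i]-th coordinate of
   [a]. *)
pose coord (j : 'I_d * Pi) (b : Pi) : nat := tnth (iota b) j.1 == tnth (iota j.2) j.1.
apply: (degeneration_domain (x_gen := x_gen) x_ind w_mod q0 c0 xq xc (f := coord))
  => [[i a]|s t ss st eq_st].
  exact: (coord_modular HCd (fun v => v == tnth (iota a) i)).
by apply: (eq_sorted_weights HCd d_gt0 ss st) => i a; apply: (eq_st (i, a)).
Qed.
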